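(* Consider weighted token swapping on a star with distinct tokens. The minimum total cost of a sorting swap sequence equals $$D_w + 2w(x) + 2\min\{\,w(a)(\ell-1),\; w(h)(\ell+1)\,\},$$ and a swap sequence of this cost can be computed in polynomial time.
   Context: A star is a tree with one non-leaf vertex, the center vertex. Tokens are distinct; each token $t$ has a destination vertex, one token per vertex initially and one token destined for each vertex; each token has a positive weight $w(t)$, and swapping tokens $t,t'$ across an edge costs $w(t)+w(t')$. A sorting swap sequence brings every token to its destination. Consider the permutation of tokens in which the successor of token $t$ is the token initially on $t$'s destination; its cycles are the cycles of the instance. The unlocked cycle $X$ is the cycle containing the token initially on the center vertex (it may be a trivial cycle of length 1); every other cycle is locked, and $\ell$ is the number of locked cycles of length at least $2$. A leaf is happy if its initial token has it as destination; $H$ is the set of tokens initially on happy leaves and $A$ is the set of all other tokens. Let $x$ be a minimum-weight token of $X$, $a$ a minimum-weight token of $A$, and $h$ a minimum-weight token of $H$; if $H$ is empty the term $w(h)(\ell+1)$ is omitted from the minimum. For a token $t$ let $d(t)$ be the distance from its initial vertex to its destination, and $D_w=\sum_t w(t)d(t)$. *)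

(* Defs.v *)
From HB Require Import structures.
From mathcomp Require Import all_boot all_order fingroup perm all_algebra.

Set Implicit Arguments.
Unset Strict Implicit.
Unset Printing Implicit Defensive.

Import Order.TTheory GRing.Theory Num.Theory.

Section Graphs.
Variables (V : finType) (e : rel V).

Definition simple_graph : Prop := symmetric e /\ irreflexive e.

Definition is_tree : Prop :=
  [/\ simple_graph,
      forall u v : V, connect e u v &
      forall p : seq V, ucycle e p -> size p <= 2].

Definition leaf (v : V) : bool := #|[set u | e v u]| == 1.

Definition is_star (c : V) : Prop :=
  is_tree /\ forall v : V, (~~ leaf v) = (v == c).

(* Length of a shortest walk from u to v; in a connected graph a walk of length
   less than #|V| always exists. *)
Definition dist (u v : V) : nat :=
  find (fun k => [exists p : k.-tuple V, path e u p && (last u p == v)])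
       (iota 0 #|V|).

End Graphs.

(* ini t is the vertex initially holding token t, tok0 v is the token initially
   on vertex v. *)
Record instance (R : realFieldType) (V T : finType) := Instance {
  edge : rel V;
  ini : T -> V;
  tok0 : V -> T;
  iniK : cancel ini tok0;
  tok0K : cancel tok0 ini;
  dest : T -> V;
  dest_bij : bijective dest;
  weight : T -> R;
  weight_gt0 : forall t, (0 < weight t)%R
}.

Section TokenSwapping.
Variables (R : realFieldType) (V T : finType) (I : instance R V T).

(* A configuration maps each vertex to the token on it. *)
Definition swap (cfg : V -> T) (p : V * V) : V -> T :=
  fun v => cfg (tperm p.1 p.2 v).

Definition sorting (s : seq (V * V)) : Prop :=
  all (fun p => edge I p.1 p.2) s /\
  forall v : V, dest I (foldl swap (tok0 I) s v) = v.

Fixpoint cost_from (cfg : V -> T) (s : seq (V * V)) : R :=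
  if s is p :: s' then
    (weight I (cfg p.1) + weight I (cfg p.2) + cost_from (swap cfg p) s')%R
  else 0%R.

Definition cost (s : seq (V * V)) : R := cost_from (tok0 I) s.

Definition is_min_sorting_cost (m : R) : Prop :=
  (exists s, sorting s /\ cost s = m) /\
  (forall s, sorting s -> (m <= cost s)%R).

Definition succ_tok (t : T) : T := tok0 I (dest I t).

Lemma succ_tok_inj : injective succ_tok.
Proof. exact: inj_comp (can_inj (tok0K I)) (bij_inj (dest_bij I)). Qed.

Definition succ_perm : {perm T} := perm succ_tok_inj.

Definition unlocked_cycle (c : V) : {set T} := porbit succ_perm (tok0 I c).

Definition num_locked (c : V) : nat :=
  #|[set C in porbits succ_perm | (C != unlocked_cycle c) && (2 <= #|C|)]|.

Definition happy (v : V) : bool := leaf (edge I) v && (dest I (tok0 I v) == v).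

Definition Hset : {set T} := [set tok0 I v | v in happy].
Definition Aset : {set T} := ~: Hset.

Definition min_token (B : {set T}) (t : T) : Prop :=
  t \in B /\ forall t', t' \in B -> (weight I t <= weight I t')%R.

(* None stands for the absence of a minimum, when B is empty. *)
Definition min_token_opt (B : {set T}) (ot : option T) : Prop :=
  if ot is Some t then min_token B t else B = set0.

Definition token_dist (t : T) : nat := dist (edge I) (ini I t) (dest I t).

Definition Dw : R := (\sum_(t : T) weight I t * (token_dist t)%:R)%R.

Definition star_value (c : V) (x a : T) (oh : option T) : R :=
  let l := ((num_locked c)%:R : R)%R in
  let via_a := (weight I a * (l - 1))%R in
  (Dw + 2 * weight I x +
   2 * (if oh is Some h then Num.min via_a (weight I h * (l + 1))
        else via_a))%R.

End TokenSwapping.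

(* Random access machine with logarithmic cost (Cook-Reckhow), with structured
   control flow: read-only input sequence, memory of natural numbers initially
   zero, append-only output. Sub is truncated subtraction. *)
Inductive expr :=
  | Const of nat
  | Mem of expr
  | Inp of expr
  | Add of expr & expr
  | Sub of expr & expr
  | Mul of expr & expr.

Inductive cmd :=
  | Skip
  | Store of expr & expr
  | Output of expr
  | Seq of cmd & cmd
  | If of expr & cmd & cmd
  | While of expr & cmd.

Definition bits (n : nat) : nat := (trunc_log 2 n).+1.

Definition mem_state := nat -> nat.
Definition state := (mem_state * seq nat)%type.

Section Semantics.
Variable inp : seq nat.

Fixpoint eval (m : mem_state) (e : expr) : nat :=
  match e with
  | Const k => k
  | Mem e1 => m (eval m e1)
  | Inp e1 => nth 0 inp (eval m e1)
  | Add e1 e2 => eval m e1 + eval m e2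
  | Sub e1 e2 => eval m e1 - eval m e2
  | Mul e1 e2 => eval m e1 * eval m e2
  end.

(* Each node is charged the bit length of its value, so that every operation is
   charged the lengths of its operands (or address) and of its result. *)
Fixpoint ecost (m : mem_state) (e : expr) : nat :=
  bits (eval m e) +
  match e with
  | Const _ => 0
  | Mem e1 | Inp e1 => ecost m e1
  | Add e1 e2 | Sub e1 e2 | Mul e1 e2 => ecost m e1 + ecost m e2
  end.

Definition update (m : mem_state) (i x : nat) : mem_state :=
  fun j => if j == i then x else m j.

(* exec p s s' t: started in s, p halts in s' after time t. *)
Inductive exec : cmd -> state -> state -> nat -> Prop :=
  | ExecSkip s : exec Skip s s 1
  | ExecStore e1 e2 m o :
      exec (Store e1 e2) (m, o) (update m (eval m e1) (eval m e2), o)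
           (1 + ecost m e1 + ecost m e2)
  | ExecOutput e m o :
      exec (Output e) (m, o) (m, rcons o (eval m e)) (1 + ecost m e)
  | ExecSeq p1 p2 s1 s2 s3 t1 t2 :
      exec p1 s1 s2 t1 -> exec p2 s2 s3 t2 ->
      exec (Seq p1 p2) s1 s3 (t1 + t2)
  | ExecIfTrue e p1 p2 s s' t :
      eval s.1 e != 0 -> exec p1 s s' t ->
      exec (If e p1 p2) s s' (1 + ecost s.1 e + t)
  | ExecIfFalse e p1 p2 s s' t :
      eval s.1 e = 0 -> exec p2 s s' t ->
      exec (If e p1 p2) s s' (1 + ecost s.1 e + t)
  | ExecWhileTrue e p s1 s2 s3 t1 t2 :
      eval s1.1 e != 0 -> exec p s1 s2 t1 -> exec (While e p) s2 s3 t2 ->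
      exec (While e p) s1 s3 (1 + ecost s1.1 e + t1 + t2)
  | ExecWhileFalse e p s :
      eval s.1 e = 0 -> exec (While e p) s s (1 + ecost s.1 e).

End Semantics.

Definition input_length (inp : seq nat) : nat := \sum_(k <- inp) bits k.

Definition poly_time_solvable (X : Type) (enc : X -> seq nat)
    (sol : X -> seq nat -> Prop) : Prop :=
  exists (p : cmd) (C k : nat), forall x : X,
  exists (m : mem_state) (out : seq nat) (t : nat),
  [/\ exec (enc x) p (fun=> 0, [::]) (m, out) t,
      t <= C * input_length (enc x) ^ k &
      sol x out].

(* Inputs of the algorithm: vertices and tokens are numbered from 0, weights are
   rational so as to have a finite encoding. *)
Record star_input := StarInput {
  in_n : nat;
  in_inst : instance rat 'I_in_n 'I_in_n;
  in_center : 'I_in_n;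
  in_star : is_star (edge in_inst) in_center
}.

(* The number of vertices and the center determine the edges of a star. *)
Definition enc_input (J : star_input) : seq nat :=
  let I := in_inst J in
  in_n J :: nat_of_ord (in_center J) ::
  [seq nat_of_ord (tok0 I v) | v <- enum 'I_(in_n J)] ++
  [seq nat_of_ord (dest I t) | t <- enum 'I_(in_n J)] ++
  [seq `|numq (weight I t)|%N | t <- enum 'I_(in_n J)] ++
  [seq `|denq (weight I t)|%N | t <- enum 'I_(in_n J)].

Definition enc_swaps (n : nat) (s : seq ('I_n * 'I_n)) : seq nat :=
  flatten [seq [:: nat_of_ord p.1; nat_of_ord p.2] | p <- s].

Definition encodes_star_solution (J : star_input) (out : seq nat) : Prop :=
  let I := in_inst J in
  let c := in_center J in
  exists s : seq ('I_(in_n J) * 'I_(in_n J)),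
  [/\ out = enc_swaps s, sorting I s &
      forall (x a : 'I_(in_n J)) (oh : option 'I_(in_n J)),
        min_token I (unlocked_cycle I c) x ->
        min_token I (Aset I) a ->
        min_token_opt I (Hset I) oh ->
        cost I s = star_value I c x a oh].

(* Main.v *)
From Stdlib Require Import FunctionalExtensionality.
From mathcomp Require Import all_boot all_order fingroup perm all_algebra.
From mathcomp Require Import zify ring lra.
Require Import Defs.

(**
  Charge every swap against the potential "sum of w(t) times the distance of t
  to its destination".  Exchanging the token t on the center with the token t'
  on the leaf v costs exactly the drop in potential, plus 2w(t) if v is not the
  destination of t, plus 2w(t') if t' was home.  So the minimum cost is D_w plus
  the minimum total of these extras.

  Lower bound: when a cycle is touched for the first time, the token on the
  center comes from a cycle touched before, hence lands on a wrong leaf.  There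
  are at least l such first touches, the first of them made by a token of X.  A
  token of H can only make one after its own leaf has been touched, which is an
  additional first touch and moves a token that was home.

  Upper bound: walk through X until x is on the center.  Either x opens all
  locked cycles in turn, or x opens the cycle of a helper token g, and g opens
  all the others before its own cycle is closed.  Opening a cycle, walking
  through it and closing it costs an extra of twice the weight of the opening
  token.  The best g minimizes w(g)(l-1) if g is in A and w(g)(l+1) if g is in
  H; if the best g is in X, then x can play its role.

  The algorithm outputs this schedule directly from the vertex permutation
  sending v to the destination of the token initially on v, marking the vertices
  of the cycles already treated; it never simulates the configuration.
*)

Set Implicit Arguments.
Unset Strict Implicit.
Unset Printing Implicit Defensive.

Import Order.TTheory GRing.Theory Num.Theory.

(** * Swaps on a star and the potential *)

Lemma find_iota (P : pred nat) (N k : nat) :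
  k < N -> P k -> (forall j, j < k -> ~~ P j) -> find P (iota 0 N) = k.
Proof.
move=> ltkN Pk nP.
have hasP : has P (iota 0 N) by apply/hasP; exists k; rewrite ?mem_iota.
have ltf : find P (iota 0 N) < N by rewrite -{2}(size_iota 0 N) -has_find.
apply/eqP; rewrite eqn_leq; apply/andP; split; rewrite leqNgt; apply/negP=> lt.
  by have := before_find 0 lt; rewrite nth_iota // add0n Pk.
by have := nth_find 0 hasP; rewrite nth_iota // add0n; apply/negP/nP.
Qed.

(** A vertex other than [c] has exactly one neighbour. Two adjacent leaves would therefore form a
    component of their own, against connectedness with [c]. *)
Lemma star_edgeE (V : finType) (e : rel V) (c : V) : is_star e c ->
  forall u v, e u v = (u != v) && ((u == c) || (v == c)).
Proof.
case=> [[[sym irr] conn _] leafE].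
have nbr u v : u != c -> e u v -> v = c.
  move=> uc euv; apply/eqP; apply: contraT => vc.
  have leaf1 w : w != c -> exists z, forall y, e w y = (y == z).
    rewrite -leafE negbK => /cards1P[z Ez]; exists z => y.
    by have := in_set1 y z; rewrite -Ez inE.
  have [z eu] := leaf1 _ uc; have [z' ev] := leaf1 _ vc.
  have vz : v = z by apply/eqP; rewrite -eu.
  have uz' : u = z' by apply/eqP; rewrite -ev sym.
  have cl : closed e (mem [:: u; v]).
    apply: intro_closed; first exact: sym_connect_sym.
    move=> x y exy; rewrite !inE => /orP[] /eqP xE; move: exy; rewrite xE.
      by rewrite eu vz => ->; rewrite orbT.
    by rewrite ev uz' => ->.
  have := closed_connect cl (conn u c); rewrite !inE eqxx /= => /esym.
  by rewrite eq_sym (negbTE uc) eq_sym (negbTE vc).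
have toc u : u != c -> e u c.
  rewrite -leafE negbK => uc; move: (uc) => /cards1P[z Ez].
  have euz : e u z by have := in_set1 z z; rewrite -Ez inE eqxx.
  by rewrite -(nbr u z) //; rewrite -leafE negbK.
move=> u v; have [<-|uv] /= := eqVneq u v; first exact: irr.
have [uc|uc] /= := eqVneq u c; first by rewrite uc sym toc // -uc eq_sym.
have [->|vc] /= := eqVneq v c; first exact: toc.
by apply/negP=> /(nbr _ _ uc) /eqP; apply/negP.
Qed.

Definition star_dist (V : eqType) (c u v : V) : nat :=
  if u == v then 0 else if (u == c) || (v == c) then 1 else 2.

Lemma dist_star (V : finType) (e : rel V) (c : V) : is_star e c ->
  dist e =2 star_dist c.
Proof.
move=> star u v; have eE := star_edgeE star; rewrite /dist /star_dist.
set P := fun k => _.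
have P0 : P 0 = (u == v).
  apply/existsP/idP => [[p]|uv]; last by exists [tuple].
  by rewrite (tuple0 p).
have P1 : P 1 = e u v.
  apply/existsP/idP => [[p]|uv]; last by exists [tuple v]; rewrite /= uv eqxx.
  by case/tupleP: p => z p; rewrite (tuple0 p) /= andbT => /andP[? /eqP <-].
(* Exhibiting [k.+1] distinct vertices shows that [k] lies in the range searched by [find]. *)
have cardS (s : seq V) : uniq s -> size s <= #|V|.
  by move=> /card_uniqP <-; apply: max_card.
have [uv|uv] := eqVneq u v.
  by apply: find_iota => //; rewrite ?P0 ?uv // (cardS [:: u]).
case: ifPn => [uvc|].
  apply: find_iota; rewrite ?P1 ?eE ?uv //.
    by rewrite (cardS [:: u; v]) //= inE uv.
  by case=> // _; rewrite P0.
rewrite negb_or => /andP[uc vc]; apply: find_iota.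
- by rewrite (cardS [:: u; v; c]) //= !inE negb_or uv uc vc.
- apply/existsP; exists [tuple c; v]; rewrite /= !eE eqxx uc orbT /=.
  by rewrite eq_sym vc eqxx.
by case=> [|[|//]] _; rewrite ?P0 ?P1 // eE uv (negbTE uc) (negbTE vc).
Qed.

Section StarInstance.
Variables (R : realFieldType) (V T : finType) (I : instance R V T) (c : V).
Hypothesis star : is_star (edge I) c.

Implicit Types (f : V -> T) (v u : V) (t : T).

Notation w := (weight I).
Notation dst := (dest I).

Lemma tok0_inj : injective (tok0 I). Proof. exact: can_inj (tok0K I). Qed.

Lemma dest_inj : injective dst. Proof. exact: bij_inj (dest_bij I). Qed.

Lemma leaf_star v : leaf (edge I) v = (v != c).
Proof. by rewrite -(negbK (leaf _ _)) star.2. Qed.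

Local Open Scope ring_scope.

(** Indexed by vertices, so that it makes sense for every configuration and a swap changes only two
    terms. *)
Definition potential f : R :=
  \sum_v w (f v) * (star_dist c v (dst (f v)))%:R.

Lemma Dw_potential : Dw I = potential (tok0 I).
Proof.
rewrite /Dw /potential (reindex (tok0 I)) /=; last first.
  by exists (ini I) => ? _; [apply: tok0K | apply: iniK].
by apply: eq_bigr => v _; rewrite /token_dist tok0K (dist_star star).
Qed.

Lemma potential_sorted f : (forall v, dst (f v) = v) -> potential f = 0.
Proof.
by move=> fK; apply: big1 => v _; rewrite fK /star_dist eqxx mulr0.
Qed.

(* The cost of a swap that its drop in potential does not pay for. *)
Definition swap_extra f v : R :=
  2 * (w (f c) * (dst (f c) != v)%:R) + 2 * (w (f v) * (dst (f v) == v)%:R).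

Lemma swap_extra_ge0 f v : 0 <= swap_extra f v.
Proof. by rewrite addr_ge0 // !mulr_ge0 ?ler0n // ltW ?weight_gt0. Qed.

(** Each of the two tokens changes its distance by exactly one. A move that shortens the distance is
    paid for by the potential; one that lengthens it leaves twice the weight uncovered. *)
Lemma swap_potential f v : v != c ->
  w (f c) + w (f v) + potential (swap f (c, v)) = potential f + swap_extra f v.
Proof.
move=> vc; rewrite /potential (bigD1 c) // (bigD1 v) //=.
rewrite [in RHS](bigD1 c) // [in RHS](bigD1 v) //= /swap /= tpermL tpermR.
rewrite (eq_bigr (fun u => w (f u) * (star_dist c u (dst (f u)))%:R)); last first.
  by move=> u /andP[uc uv]; rewrite tpermD // eq_sym.
rewrite /swap_extra /star_dist !eqxx (negbTE vc) /=.
set S := \sum_(i | _) _.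
rewrite ![c == dst _]eq_sym ![v == dst _]eq_sym.
have [cd|cd] := eqVneq (dst (f c)) c;
have [cv|cv] := eqVneq (dst (f c)) v;
have [vd|vd] := eqVneq (dst (f v)) c;
have [vv|vv] := eqVneq (dst (f v)) v => /=; try lra.
(* The remaining cases give one token both [c] and [v] as destination. *)
all: by move: vc; first [rewrite -cv cd eqxx | rewrite -vv vd eqxx].
Qed.

(** * Lower bound *)

Notation sperm := (succ_perm I).

Lemma mem_Hset t : (t \in Hset I) = (ini I t != c) && (dst t == ini I t).
Proof.
apply/imsetP/andP => [[v]|[tc /eqP dt]].
  by rewrite unfold_in /happy leaf_star => /andP[vc /eqP dv] ->; rewrite tok0K dv.
by exists (ini I t); rewrite ?iniK // unfold_in /happy leaf_star iniK tc dt eqxx.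
Qed.

Lemma tok0_Hset v : (tok0 I v \in Hset I) = (v != c) && (dst (tok0 I v) == v).
Proof. by rewrite mem_Hset tok0K. Qed.

Lemma succ_permE v : sperm (tok0 I v) = tok0 I (dst (tok0 I v)).
Proof. by rewrite permE. Qed.

Lemma mem_porbit1 (p : {perm T}) t : p t \in porbit p t.
Proof. by have := mem_porbit p 1 t; rewrite expg1. Qed.

Lemma porbit_disjoint (p : {perm T}) (t u : T) :
  (porbit p t != porbit p u) = [disjoint porbit p t & porbit p u].
Proof.
rewrite -setI_eq0; apply/idP/idP => [|/eqP dis].
  apply: contraR => /set0Pn[z].
  by rewrite inE -!eq_porbit_mem => /andP[/eqP <- /eqP <-].
apply/eqP=> E; have /setP/(_ t) := dis.
by rewrite -E setIid inE porbit_id.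
Qed.

Lemma card_porbit_gt1 t : (1 < #|porbit sperm t|)%N = (sperm t != t).
Proof.
have [st|st] := eqVneq (sperm t) t.
  apply/negbTE; rewrite -leqNgt -(cards1 t) subset_leq_card //.
  apply/subsetP=> u /porbitP[i ->]; rewrite inE permX; apply/eqP.
  by elim: i => //= i ->.
apply/card_gt1P; exists (sperm t), t.
by split; rewrite ?porbit_id ?mem_porbit1.
Qed.

(** Parametrised by [S] so that the count can follow the cycles still untouched; the unlocked cycle
    as [S] gives [num_locked]. *)
Definition locked_cycles (S : {set T}) : {set {set T}} :=
  [set C in porbits sperm | (1 < #|C|)%N && [disjoint C & S]].

Lemma num_lockedE : num_locked I c = #|locked_cycles (unlocked_cycle I c)|.
Proof.
apply: eq_card => C; rewrite !inE; case: imsetP => //= -[t _ ->].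
by rewrite andbC /unlocked_cycle porbit_disjoint.
Qed.

Definition orbit_closed (S : {set T}) := forall t, t \in S -> porbit sperm t \subset S.

Lemma orbit_closedU S t : orbit_closed S -> orbit_closed (S :|: porbit sperm t).
Proof.
move=> clS u; rewrite inE => /orP[/clS uS|].
  exact: subset_trans uS (subsetUl _ _).
by rewrite -eq_porbit_mem => /eqP ->; apply: subsetUr.
Qed.

(** Closure of [S] makes the orbit of [t] disjoint from it, so exactly this orbit stops being
    counted, provided that it is nontrivial. *)
Lemma locked_cyclesU S t : orbit_closed S -> t \notin S ->
  #|locked_cycles S| =
    (#|locked_cycles (S :|: porbit sperm t)| + (sperm t != t))%N.
Proof.
move=> clS tS; set C0 := porbit _ t.
have disC0 : [disjoint C0 & S].
  rewrite -setI_eq0; apply: contraR tS => /set0Pn[u]; rewrite inE => /andP[ut uS].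
  by apply: (subsetP (clS _ uS)); rewrite -eq_porbit_mem eq_sym eq_porbit_mem.
rewrite (cardsD1 C0) addnC; congr (_ + _)%N; last first.
  by rewrite inE card_porbit_gt1 disC0 andbT imset_f // inE.
apply: eq_card => C; rewrite !inE; case: imsetP => [[u _ ->]|]; last first.
  by rewrite andbF.
by rewrite /= porbit_disjoint -!setI_eq0 setIUr setU_eq0 [RHS]andbA [RHS]andbC.
Qed.

(* S collects the tokens of the cycles touched so far, f is the current
   configuration. *)
Definition touched (S : {set T}) f :=
  [/\ orbit_closed S, tok0 I c \in S, injective f &
      forall v, tok0 I v \notin S -> f v = tok0 I v].

(** A token outside [S] still lies on its initial vertex; were that the center, the token would be
    [tok0 I c], which is in [S]. *)
Lemma touched_center S f : touched S f -> f c \in S.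
Proof.
case=> _ cS finj fS; apply: contraT => fcS.
have : f (ini I (f c)) = f c by rewrite fS iniK.
by move/finj=> E; move: fcS; rewrite -[f c](iniK I) E cS.
Qed.

(** If the token on the center were destined for [v], its successor [tok0 I v] would share its cycle
    and hence lie in [S]. This is why every first touch has an extra. *)
Lemma touched_dest S f v : touched S f -> tok0 I v \notin S -> dst (f c) != v.
Proof.
move=> tS; apply: contraNneq => <-.
have [/(_ _ (touched_center tS)) /subsetP sub _ _ _] := tS.
by have := sub _ (mem_porbit1 sperm (f c)); rewrite permE.
Qed.

Lemma swap_inj f p : injective f -> injective (swap f p).
Proof. by move=> finj u v /finj /perm_inj. Qed.

Lemma touched_swap S f v : touched S f ->
  touched (S :|: porbit sperm (tok0 I v)) (swap f (c, v)).
Proof.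
case=> clS cS finj fS; split; first exact: orbit_closedU.
- by rewrite inE cS.
- exact: swap_inj.
move=> u; rewrite inE negb_or => /andP[uS uv]; rewrite /swap /= tpermD ?fS //.
- by apply: contraNneq uS => <-.
- by apply: contraNneq uv => <-; apply: porbit_id.
Qed.

Lemma edge_swap f p : edge I p.1 p.2 -> exists v,
  [/\ v != c, swap f p = swap f (c, v) &
      w (f p.1) + w (f p.2) = w (f c) + w (f v)].
Proof.
case: p => u v /=; rewrite (star_edgeE star) => /andP[uv].
case/orP=> /eqP E; [exists v | exists u]; split=> //.
- by rewrite -E eq_sym.
- by rewrite E.
- by rewrite E.
- by rewrite -E.
- by rewrite E /swap /= tpermC.
- by rewrite E addrC.
Qed.

(** Amortization: [F S] bounds the extras still to come in terms of the touched cycles alone. Swaps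
    at touched vertices keep [S] and have a nonnegative extra, so only first touches need an
    inequality. *)
Lemma lower_bound_from (F : {set T} -> R) :
    (forall S f, touched S f -> #|locked_cycles S| = 0%N -> F S <= 0) ->
    (forall S f v, touched S f -> v != c -> tok0 I v \notin S ->
       F S <= swap_extra f v + F (S :|: porbit sperm (tok0 I v))) ->
  forall s S f, touched S f -> all (fun p => edge I p.1 p.2) s ->
    (forall v, dst (foldl (@swap V T) f s v) = v) ->
  potential f + F S <= cost_from I f s.
Proof.
move=> F0 FU; elim=> [|p s IHs] S f tS /=.
  move=> _ fK; rewrite potential_sorted // add0r; apply: (F0 S f tS).
  apply/eqP; rewrite cards_eq0; apply/set0Pn=> -[C]; rewrite inE.
  case: imsetP => //= -[t _ ->]; rewrite card_porbit_gt1 => /andP[st].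
  (* An untouched token of a sorted configuration was home from the start, so its cycle is
     trivial. *)
  have tIS : t \in S.
    apply: contraT => tNS; have [_ _ _ fS] := tS.
    move: (fK (ini I t)); rewrite fS ?iniK // => dt.
    by move: st; rewrite -[t](iniK I) succ_permE iniK dt iniK eqxx.
  rewrite -setI_eq0 => /eqP/setP/(_ t).
  by rewrite !inE porbit_id tIS.
case/andP=> /(edge_swap f)[v [vc -> ->]] all_s fK.
have step S' : touched S' (swap f (c, v)) -> F S <= swap_extra f v + F S' ->
    potential f + F S <= w (f c) + w (f v) + cost_from I (swap f (c, v)) s.
  move=> tS' leF; have := IHs _ _ tS' all_s fK; have := swap_potential f vc.
  by move: leF; lra.
have [vS|vS] := boolP (tok0 I v \in S); last first.
  exact: step (touched_swap v tS) (FU _ _ _ tS vc vS).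
apply: (step S); last by rewrite ler_wpDl ?swap_extra_ge0.
have := touched_swap v tS; suff /setUidPl -> : porbit sperm (tok0 I v) \subset S by [].
by case: tS => + _ _ _; apply.
Qed.

Lemma touched_unlocked : touched (unlocked_cycle I c) (tok0 I).
Proof.
split=> //; [|exact: porbit_id|exact: tok0_inj] => t.
by rewrite -eq_porbit_mem => /eqP ->.
Qed.

Lemma unlocked_sub S : orbit_closed S -> tok0 I c \in S -> unlocked_cycle I c \subset S.
Proof. by apply. Qed.

(** Happy tokens are fixed by [succ_perm], so a nontrivial cycle contains none of them. *)
Lemma porbit_sub_Aset t : sperm t != t -> porbit sperm t \subset Aset I.
Proof.
move=> st; apply/subsetP=> u; rewrite -eq_porbit_mem !inE mem_Hset => /eqP E.
have : (1 < #|porbit sperm u|)%N by rewrite E card_porbit_gt1.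
rewrite card_porbit_gt1 negb_and => su; apply/orP; right; apply: contra su => /eqP dt.
by rewrite -{1}[u](iniK I) succ_permE iniK dt iniK.
Qed.

Lemma unlocked_sub_Aset : unlocked_cycle I c \subset Aset I.
Proof.
have [sc|] := eqVneq (sperm (tok0 I c)) (tok0 I c); last exact: porbit_sub_Aset.
have := card_porbit_gt1 (tok0 I c); rewrite sc eqxx => /negbT.
rewrite -leqNgt => /card_le1_eqP E; apply/subsetP=> t tX.
by rewrite (E _ _ (porbit_id _ _) tX) !inE tok0_Hset eqxx.
Qed.

(** Arbitrary lower bounds [wx], [wa], [wh] stand for the minimum weights, so that an empty [H] can
    be handled by taking [wa] for [wh]. *)
Lemma locked_lower_bound (wx wa wh : R) :
    (forall t, t \in unlocked_cycle I c -> wx <= w t) ->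
    (forall t, t \in Aset I -> wa <= w t) ->
    (forall t, t \in Hset I -> wh <= w t) ->
    0 < wa -> 0 < wh -> (0 < num_locked I c)%N ->
  forall s, sorting I s ->
  Dw I + 2 * wx + 2 * Num.min (wa * ((num_locked I c)%:R - 1))
                              (wh * ((num_locked I c)%:R + 1)) <= cost I s.
Proof.
move=> le_wx le_wa le_wh wa_gt0 wh_gt0 l_gt0 s [all_s sK].
pose X := unlocked_cycle I c; pose r S : R := #|locked_cycles S|%:R.
(* [F] has three phases. At [X] the next opener is in the unlocked cycle and pays at least [wx].
   Until a happy token is touched, all openers weigh at least [wa]; touching one then costs twice at
   least [wa + wh], and [wa + wh] is at least [2 * wh] when [wh <= wa], whence the [+ 2]. Afterwards
   each remaining cycle costs twice at least the smaller of both weights. *)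
pose F (S : {set T}) : R :=
  if S == X then 2 * wx + 2 * Num.min (wa * (r S - 1)) (wh * (r S + 1))
  else if S :&: Hset I == set0 then 2 * Num.min (wa * r S) (wh * (r S + 2))
  else 2 * (r S * Num.min wa wh).
have -> : Dw I + 2 * wx + 2 * Num.min (wa * ((num_locked I c)%:R - 1))
                              (wh * ((num_locked I c)%:R + 1)) = potential (tok0 I) + F X.
  by rewrite /F eqxx Dw_potential /r num_lockedE addrA.
apply: lower_bound_from touched_unlocked all_s sK => [S f tS r0|S f v tS vc vS].
  rewrite /F /r r0; case: ifP => [/eqP SX|_].
    by move: l_gt0; rewrite num_lockedE -/X -SX r0.
  case: ifP => _; last by rewrite mul0r mulr0.
  by rewrite mulr0 add0r min_l ?mulr0 // mulr_ge0 // ltW.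
set S' := S :|: _.
have [clS cS _ fS] := tS.
have S'X : S' == X = false.
  apply: contraNF vS => /eqP E; have : tok0 I v \in S' by rewrite !inE porbit_id orbT.
  by rewrite E; apply: (subsetP (unlocked_sub clS cS)).
have XH : X :&: Hset I = set0.
  apply/eqP; rewrite setI_eq0 disjoints_subset; exact: unlocked_sub_Aset.
have r_ge0 : 0 <= r S' by apply: ler0n.
have fcS := touched_center tS.
have wfc : Num.min wa wh <= w (f c).
  rewrite ge_min; have [|] := boolP (f c \in Hset I) => H.
    by rewrite le_wh ?orbT.
  by rewrite le_wa // inE.
have wfcA : S :&: Hset I == set0 -> wa <= w (f c).
  move=> SH; apply: le_wa; rewrite inE; apply: contraL SH => fcH.
  by apply/set0Pn; exists (f c); rewrite inE fcS.
have wfcX : S == X -> wx <= w (f c) by move=> /eqP E; apply: le_wx; rewrite -/X -E.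
have minle (y z : R) : Num.min y z <= y /\ Num.min y z <= z.
  by rewrite !ge_min !lexx orbT.
have extra : 2 * w (f c) + 2 * (w (tok0 I v) * (tok0 I v \in Hset I)%:R)
   <= swap_extra f v.
  by rewrite /swap_extra (touched_dest tS vS) (fS v vS) tok0_Hset vc mulr1.
have rS : r S = r S' + (sperm (tok0 I v) != tok0 I v)%:R.
  by rewrite /r (locked_cyclesU clS vS) natrD.
have hv : (sperm (tok0 I v) == tok0 I v) = (tok0 I v \in Hset I).
  by rewrite tok0_Hset vc succ_permE (inj_eq tok0_inj).
apply: le_trans (lerD extra (lexx _)); rewrite /F S'X; move: rS; rewrite hv.
(* Touching a happy leaf leaves the count [r] unchanged, but adds the weight of its own token and
   leads to the third phase. *)
have [vH|vH] := boolP (tok0 I v \in Hset I) => /= rS.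
  have wv := le_wh _ vH.
  have S'H : S' :&: Hset I == set0 = false.
    by apply/negbTE/set0Pn; exists (tok0 I v); rewrite !inE porbit_id orbT.
  rewrite S'H mulr1; move: rS; rewrite addr0 => ->.
  case: ifP => [/wfcX wfc'|_].
    have := minle (wa * (r S' - 1)) (wh * (r S' + 1)).
    by set m := Num.min _ _; case: (leP wa wh) wfc => wfc lewx [ml mr]; lra.
  case: ifP => [/wfcA wfc'|_].
    have := minle (wa * r S') (wh * (r S' + 2)).
    by set m := Num.min _ _; case: (leP wa wh) wfc => wfc lewx [ml mr]; lra.
  by move: (weight_gt0 I (f c)); lra.
have S'H : (S' :&: Hset I == set0) = (S :&: Hset I == set0).
  rewrite setIUl setU_eq0 [X in _ && X](_ : _ = true) ?andbT //.
  by rewrite setI_eq0 disjoints_subset porbit_sub_Aset // hv.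
rewrite S'H rS mulr0 mulr0 addr0.
case: ifP => [/[dup] /wfcX wfc' /eqP ->|_].
  rewrite XH eqxx; set m := Num.min _ _; set m' := Num.min _ _.
  have -> : m = m' by rewrite /m /m'; congr Num.min; ring.
  lra.
case: ifP => [/wfcA wfc'|_]; last by rewrite mulrDl mul1r; lra.
have [ml mr] := minle (wa * (r S' + 1)) (wh * (r S' + 1 + 2)).
(* Products with [r S'] are nonlinear for [lra], so their sign and order are supplied beforehand. *)
have rwh : 0 <= r S' * wh by rewrite mulr_ge0 // ltW.
have [wawh|wawh] := leP wa wh; last first.
  by move: ml mr; set m := Num.min _ _; case: (leP (wa * r S')) => _ ml mr; lra.
have rw : r S' * wa <= r S' * wh by apply: ler_wpM2l.
by move: ml mr; set m := Num.min _ _; case: (leP (wa * r S')) => _ ml mr; lra.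
Qed.

(** A token that is not happy either starts on the center or has a nontrivial cycle, which can only
    be the unlocked one. *)
Lemma Aset_no_locked : num_locked I c = 0%N -> Aset I = unlocked_cycle I c.
Proof.
rewrite num_lockedE => /eqP; rewrite cards_eq0 => /eqP L0.
apply/eqP; rewrite eqEsubset unlocked_sub_Aset andbT; apply/subsetP=> t.
rewrite !inE mem_Hset negb_and negbK.
case/orP=> [/eqP E|dt]; first by rewrite -[t](iniK I) E porbit_id.
rewrite -/(unlocked_cycle I c); apply: contraT => tX.
have : porbit sperm t \in locked_cycles (unlocked_cycle I c).
  rewrite inE imset_f // card_porbit_gt1 -porbit_disjoint eq_porbit_mem tX andbT /=.
  by rewrite -[t](iniK I) succ_permE iniK -[X in _ != X](iniK I) (inj_eq tok0_inj).
by rewrite L0 inE.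
Qed.

Lemma star_lower_bound (x a : T) (oh : option T) :
    min_token I (unlocked_cycle I c) x -> min_token I (Aset I) a ->
    min_token_opt I (Hset I) oh ->
  forall s, sorting I s -> star_value I c x a oh <= cost I s.
Proof.
move=> [xX le_x] [aA le_a] Hoh s sK.
have wa_gt0 := weight_gt0 I a.
case: (posnP (num_locked I c)) => [l0|l_gt0]; last first.
  rewrite /star_value; case: oh Hoh => [h [hH le_h]|H0].
    exact: locked_lower_bound (weight_gt0 I h) _ _ sK.
  (* With [H] empty, [wa] serves as [wh]; the second argument of the minimum is then the larger
     one. *)
  have le_h t : t \in Hset I -> w a <= w t by rewrite H0 inE.
  have := locked_lower_bound le_x le_a le_h wa_gt0 wa_gt0 l_gt0 sK.
  by rewrite min_l // ler_pM2l // lerD2l; lra.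
(* Without locked cycles [x] and [a] have equal weight and the factor [l - 1] is [-1], so both terms
   cancel and the constant [F = 0] suffices. *)
have AX := Aset_no_locked l0.
have wxa : w x = w a by apply/le_anti; rewrite le_x -?AX // le_a // AX.
have -> : star_value I c x a oh = Dw I.
  rewrite /star_value l0 /= wxa; case: oh {Hoh} => [h|]; last by lra.
  by rewrite min_l; have := weight_gt0 I h; lra.
rewrite Dw_potential -[leLHS]addr0; case: sK => all_s sK.
apply: (@lower_bound_from (fun=> 0)) touched_unlocked all_s sK => // S f v _ _ _.
by rewrite addr0 swap_extra_ge0.
Qed.

End StarInstance.

(** * The optimal schedule *)

Section Schedule.
Variables (V : finType) (sigma : V -> V).
Hypothesis sigma_inj : injective sigma.

Definition orbit_tail (v : V) : seq V :=
  traject sigma (sigma v) (fingraph.order sigma v).-1.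

Lemma orbit_cons v : orbit sigma v = v :: orbit_tail v.
Proof. by rewrite /orbit -orderSpred. Qed.

Lemma orbit_tail_nil v : (orbit_tail v == [::]) = (sigma v == v).
Proof.
have := iter_order sigma_inj v; have := orbit_uniq sigma v.
rewrite orbit_cons -orderSpred /orbit_tail.
case: _.-1 => [|k] /= ; first by move=> _ ->; rewrite !eqxx.
by rewrite inE negb_or eq_sym; case: eqP.
Qed.

Lemma orbit_tail_split v u (i := findex sigma v u) : u \in orbit sigma v ->
  orbit_tail v = traject sigma (sigma v) i ++
    traject sigma (sigma u) ((fingraph.order sigma v).-1 - i).
Proof.
rewrite -fconnect_orbit => vu; have := findex_max vu; rewrite -/i => lt_i.
rewrite /orbit_tail -{1}(@subnKC i (fingraph.order sigma v).-1).
  by rewrite trajectD -iterSr /= iter_findex.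
by rewrite -ltnS orderSpred.
Qed.

Lemma mem_orbit_sym u v : (u \in orbit sigma v) = (v \in orbit sigma u).
Proof. by rewrite -!fconnect_orbit fconnect_sym. Qed.

Lemma mem_orbit_trans u v z :
  u \in orbit sigma v -> v \in orbit sigma z -> u \in orbit sigma z.
Proof. by rewrite -!fconnect_orbit => uv vz; apply: connect_trans vz uv. Qed.

Definition orbits (rs : seq V) : seq V := flatten [seq orbit sigma r | r <- rs].

(** [rs] picks one vertex from each nontrivial cycle of [sigma] outside [S], where [S] is a union of
    cycles. *)
Definition transversal (S rs : seq V) : Prop :=
  [/\ forall u v, u \in S -> v \in orbit sigma u -> v \in S,
      uniq (orbits rs) && ~~ has (mem S) (orbits rs),
      all (fun r => sigma r != r) rs &
      forall v, sigma v != v -> (v \in S) || (v \in orbits rs)].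

(** Mirrors the loop of the program, with [S] in the role of the marked vertices. *)
Fixpoint scan (S vs : seq V) : seq V :=
  if vs is v :: vs' then
    if (v \in S) || (sigma v == v) then scan S vs'
    else v :: scan (orbit sigma v ++ S) vs'
  else [::].

Lemma scan_transversal S :
  (forall u v, u \in S -> v \in orbit sigma u -> v \in S) ->
  transversal S (scan S (enum V)).
Proof.
move=> clS.
(* For the induction over the scanned list, coverage is claimed only for the vertices of [vs], and
   [S'] is arbitrary. *)
suff gen vs S' : (forall u v, u \in S' -> v \in orbit sigma u -> v \in S') ->
    [/\ uniq (orbits (scan S' vs)) && ~~ has (mem S') (orbits (scan S' vs)),
      all (fun r => sigma r != r) (scan S' vs) &
      forall v, v \in vs -> sigma v != v ->
        (v \in S') || (v \in orbits (scan S' vs))].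
  have [? ? cov] := gen (enum V) S clS; split=> // v; apply: cov.
  by rewrite mem_enum.
elim: vs S' => [|v vs IH] S' cl /=; first by split=> //; rewrite has_pred0.
case: ifPn => [vS|].
  have [? ? cov] := IH S' cl; split=> // u; rewrite inE => /orP[/eqP ->|].
    by case/orP: vS => [->//|/eqP ->]; rewrite eqxx.
  exact: cov.
rewrite negb_or => /andP[vS sv].
have cl' u z : u \in orbit sigma v ++ S' -> z \in orbit sigma u ->
    z \in orbit sigma v ++ S'.
  rewrite !mem_cat => /orP[uv|uS] zu; first by rewrite (mem_orbit_trans zu uv).
  by rewrite (cl _ _ uS zu) orbT.
have [/andP[un dis] nf cov] := IH _ cl'; split; last first.
- move=> u; rewrite inE => /orP[/eqP -> _|uvs su].
    by rewrite mem_cat orbit_cons mem_head orbT.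
  have := cov u uvs su; rewrite !mem_cat => /orP[/orP[]|] -> //.
    by rewrite orbT.
  by rewrite !orbT.
- by rewrite /= sv.
rewrite /orbits /= -/(orbits _) cat_uniq orbit_uniq un has_cat negb_or !andbT /=.
move: dis; rewrite (eq_has (a2 := predU (mem (orbit sigma v)) (mem S'))); last first.
  by move=> u; rewrite /= mem_cat.
rewrite has_predU negb_or => /andP[-> ->]; rewrite andbT /=.
apply/hasPn=> u uv; apply: contra vS => uS; apply: cl uS _.
by rewrite mem_orbit_sym.
Qed.

(** The leaf [v] occurs twice: the opener is parked there by the first swap and fetched back by the
    last. *)
Definition excursion (v : V) : seq V := v :: rcons (orbit_tail v) v.

Definition excursions (rs : seq V) : seq V := flatten [seq excursion r | r <- rs].

(* The leaves exchanged with the center c, in order: the unlocked cycle is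
   walked until the token of xv reaches the center, then the token of gv (of xv
   if gv is in the unlocked cycle) opens all other cycles. *)
Definition schedule (c xv gv : V) : seq V :=
  let i := findex sigma c xv in
  let X := orbit sigma c in
  traject sigma (sigma c) i ++
  (if gv \in X then excursions (scan X (enum V))
   else gv :: excursions (scan (orbit sigma gv ++ X) (enum V)) ++
          rcons (orbit_tail gv) gv) ++
  traject sigma (sigma xv) ((fingraph.order sigma c).-1 - i).

End Schedule.

Lemma eq_in_fpath (V : eqType) (h h' : V -> V) (x : V) (p : seq V) :
  {in belast x p, h =1 h'} -> fpath h x p = fpath h' x p.
Proof.
elim: p x => //= y p IH x hh'; rewrite hh' ?mem_head // IH // => z zp.
by rewrite hh' // inE zp orbT.
Qed.

(** * Effect and extra cost of the schedule *)

Section ScheduleCost.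
Variables (R : realFieldType) (V T : finType) (I : instance R V T) (c : V).

Implicit Types (f g : V -> T) (v u : V) (l p q : seq V).

Notation w := (weight I).
Notation dst := (dest I).

Definition center_swaps l : seq (V * V) := [seq (c, v) | v <- l].

Definition moves f l : V -> T := foldl (@swap V T) f (center_swaps l).

Local Open Scope ring_scope.

(** For leaves [l] this is the sum of [swap_extra] along the swaps, in telescoped form. *)
Definition extra f l : R :=
  cost_from I f (center_swaps l) + potential I c (moves f l) - potential I c f.

Lemma swapE f v : [/\ swap f (c, v) c = f v, swap f (c, v) v = f c &
  forall u, u != c -> u != v -> swap f (c, v) u = f u].
Proof.
rewrite /swap /= tpermL tpermR; split=> // u uc uv.
by rewrite tpermD // eq_sym.
Qed.

Lemma moves_cat f p q : moves f (p ++ q) = moves (moves f p) q.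
Proof. by rewrite /moves /center_swaps map_cat foldl_cat. Qed.

Lemma cost_from_cat f (s1 s2 : seq (V * V)) :
  cost_from I f (s1 ++ s2) =
  cost_from I f s1 + cost_from I (foldl (@swap V T) f s1) s2.
Proof. by elim: s1 f => [|p s1 IH] f /=; rewrite ?add0r // IH addrA. Qed.

Lemma extra_cat f p q : extra f (p ++ q) = extra f p + extra (moves f p) q.
Proof.
rewrite /extra moves_cat /center_swaps map_cat cost_from_cat.
by rewrite -!/(center_swaps _) -/(moves f p); lra.
Qed.

Lemma extra_cons f v l : v != c ->
  extra f (v :: l) = swap_extra I c f v + extra (swap f (c, v)) l.
Proof.
move=> vc; rewrite /extra /= -/(center_swaps l) -/(moves _ l).
by have := swap_potential I f vc; rewrite /moves /=; lra.
Qed.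

Lemma extra_nil f : extra f [::] = 0.
Proof. by rewrite /extra /= add0r subrr. Qed.

Lemma moves_inj f l : injective f -> injective (moves f l).
Proof. by elim: l f => //= v l IH f finj; apply/IH/swap_inj. Qed.

(** Each leaf of the path is the destination of the token that has just reached the center, so every
    swap takes one token home and moves none away from home. The path can be stated for the initial
    [f] because no vertex repeats. *)
Lemma moves_walk f p : injective f -> fpath (dst \o f) c p -> uniq (c :: p) ->
  [/\ moves f p c = f (last c p), forall v, v \in p -> dst (moves f p v) = v,
      forall v, v \notin c :: p -> moves f p v = f v & extra f p = 0].
Proof.
elim: p f => [|v p IH] f finj.
  by move=> _ _; split; rewrite ?extra_nil.
rewrite /= inE negb_or -andbA => /andP[/eqP dv pth] /and4P[cv cp vp up].
have [gc gv gu] := swapE f v; set g := swap f (c, v) in gc gv gu.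
have pth' : fpath (dst \o g) c p.
  case: p pth cp vp {IH up} => //= u p /andP[du pth].
  rewrite !inE !negb_or => /andP[cu cp] /andP[vu vp].
  rewrite gc du /= -(eq_in_fpath (h := dst \o f)) // => z /mem_belast zp /=.
  rewrite gu //; first by apply: contraTneq zp => ->; rewrite inE negb_or cu.
  by apply: contraTneq zp => ->; rewrite inE negb_or vu.
have := IH g (swap_inj finj) pth'; rewrite /= cp up => /(_ isT) [mc mp mo ex].
rewrite -[moves f _]/(moves g p); split.
- rewrite mc; case: (p) vp cp => [|z q] //= vq cq; rewrite gu //.
    by apply: contraNneq cq => <-; apply: mem_last.
  by apply: contraNneq vq => <-; apply: mem_last.
- move=> u; rewrite inE => /orP[/eqP ->|]; last exact: mp.
  by rewrite mo ?inE ?negb_or ?vp ?andbT 1?eq_sym // gv.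
- move=> u; rewrite !inE !negb_or => /and3P[uc uv up'].
  by rewrite mo ?gu // inE negb_or uc.
have vc : v != c by rewrite eq_sym.
rewrite extra_cons // ex addr0 /swap_extra dv eqxx.
(* Only one token is destined for [v], and it is on the center. *)
have /negbTE -> : dst (f v) != v.
  by rewrite -[X in _ != X]dv (inj_eq (@dest_inj _ _ _ I)) (inj_eq finj).
by rewrite !mulr0 addr0.
Qed.

(* The token at the center opens the cycle v :: q; the swaps l are then made
   while the token of v is at the center. *)
Lemma moves_nested f v q l : injective f ->
    fcycle (dst \o f) (v :: q) -> uniq [:: c, v & q] ->
    {in [:: c, v & q], moves (swap f (c, v)) l =1 swap f (c, v)} ->
  let f' := moves f (v :: l ++ rcons q v) in
  [/\ f' c = f c, forall u, u \in v :: q -> dst (f' u) = u,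
      forall u, u \notin [:: c, v & q] -> f' u = moves (swap f (c, v)) l u &
      extra f (v :: l ++ rcons q v) =
        2 * w (f c) + 2 * (w (f v) * (q == [::])%:R) + extra (swap f (c, v)) l].
Proof.
move=> finj cyc unq same f'.
have /= := unq; rewrite inE negb_or -andbA => /and4P[cv cq vq uq].
have [gc gv gu] := swapE f v; set g := swap f (c, v) in gc gv gu same f' *.
have ginj : injective g by apply: swap_inj.
have vc : v != c by rewrite eq_sym.
have inq z : z \in q -> z != c /\ z != v.
  by move=> zq; split; [apply: contraNneq cq | apply: contraNneq vq] => <-.
(* Once [v] is opened, the rest of the cycle is a walk from the center that ends at [v], where the
   opener waits. *)
have pth : fpath (dst \o moves g l) c (rcons q v).
  case: (q) cyc inq same {cq vq uq unq} => [|z q'] /= cyc inq same.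
    by rewrite same ?mem_head // gc.
  case/andP: cyc => dz pth; rewrite same ?mem_head // gc dz /=.
  rewrite -(eq_in_fpath (h := dst \o f)) // => u; rewrite belast_rcons => uq /=.
  have [uc uv] := inq _ uq.
  by rewrite same ?gu // !inE orbA -in_cons uq orbT.
have unq' : uniq (c :: rcons q v).
  by rewrite /= mem_rcons inE negb_or cv cq rcons_uniq vq.
have [mc mp mo ex] := moves_walk (moves_inj (l := l) ginj) pth unq'.
rewrite /f' -cat_cons moves_cat /= -/(moves g l); split.
- by rewrite mc last_rcons same ?gv // !inE eqxx orbT.
- by move=> u uq'; rewrite mp // mem_rcons.
- by move=> u; rewrite !inE => uN; rewrite mo // inE mem_rcons inE.
rewrite extra_cons // extra_cat ex addr0 /swap_extra; congr (_ + _).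
(* [v] is the destination of the last token of its own cycle, which is not the token on the
   center. *)
have dcv : dst (f c) != v.
  move: cyc; rewrite /= rcons_path => /andP[_ /eqP <-] /=.
  rewrite (inj_eq (@dest_inj _ _ _ I)) (inj_eq finj).
  by apply/eqP=> E; have := mem_last v q; rewrite -E inE (negbTE cv) (negbTE cq).
have -> : (q == [::]) = (dst (f v) == v).
  case: (q) cyc inq {cq vq uq unq same pth unq' mc mp mo ex f'} => [|z q'] /=.
    by rewrite andbT => ->.
  case/andP=> /eqP -> _ /(_ z); rewrite mem_head => /(_ isT)[_].
  by move/negbTE.
by rewrite dcv mulr1.
Qed.

Definition sigma v : V := dst (tok0 I v).

Lemma sigma_inj : injective sigma.
Proof. exact: inj_comp (@dest_inj _ _ _ I) (@tok0_inj _ _ _ I). Qed.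

Lemma fcycle_orbit f v : {in orbit sigma v, f =1 tok0 I} ->
  fcycle (dst \o f) (v :: orbit_tail sigma v).
Proof.
move=> fE; have := cycle_orbit sigma_inj v; rewrite orbit_cons /=.
rewrite (eq_in_fpath (h' := dst \o f)) // => u.
by rewrite belast_rcons -orbit_cons => uv; rewrite /sigma /= fE.
Qed.

(** Each excursion returns the opener to the center, so the next one starts under the same
    conditions and again has twice the opener's weight as extra. *)
Lemma moves_excursions rs f : injective f ->
    uniq (orbits sigma rs) -> c \notin orbits sigma rs ->
    all (fun r => sigma r != r) rs ->
    {in orbits sigma rs, f =1 tok0 I} ->
  let f' := moves f (excursions sigma rs) in
  [/\ f' c = f c, forall u, u \in orbits sigma rs -> dst (f' u) = u,
      forall u, u \notin orbits sigma rs -> f' u = f u &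
      extra f (excursions sigma rs) = 2 * w (f c) * (size rs)%:R].
Proof.
elim: rs f => [|r rs IH] f finj; first by rewrite /= extra_nil mulr0.
rewrite -[excursions _ _]/(excursion sigma r ++ excursions sigma rs).
rewrite -[orbits _ _]/(orbit sigma r ++ orbits sigma rs).
rewrite cat_uniq mem_cat negb_or => /and3P[ur dis un] /andP[cr crs] /andP[sr nf] fE.
have fEr : {in orbit sigma r, f =1 tok0 I}.
  by move=> u ur'; apply: fE; rewrite mem_cat ur'.
have unr : uniq [:: c, r & orbit_tail sigma r].
  by rewrite -orbit_cons /= cr.
have [] := @moves_nested f r (orbit_tail sigma r) [::] finj (fcycle_orbit fEr) unr.
  by [].
rewrite -orbit_cons -[r :: [::] ++ _]/(excursion sigma r).
rewrite orbit_tail_nil; last exact: sigma_inj.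
rewrite (negbTE sr) mulr0 mulr0 extra_nil !addr0; set g := moves f _ => gc gr go exr.
have disr u : u \in orbits sigma rs -> u \notin orbit sigma r.
  by move=> urs; apply: contra dis => ur'; apply/hasP; exists u.
have goE u : u != c -> u \notin orbit sigma r -> g u = f u.
  move=> uc ur'; rewrite go ?inE ?(negbTE uc) // -[LHS]/(swap f (c, r) u).
  have rc : r != c by apply: contraNneq cr => <-; rewrite in_orbit.
  by case: (swapE f r) => _ _ -> //; apply: contraNneq ur' => ->; rewrite in_orbit.
have notc u : u \in orbits sigma rs -> u != c.
  by move=> urs; apply: contraNneq crs => <-.
have gE : {in orbits sigma rs, g =1 tok0 I}.
  by move=> u urs; rewrite goE ?notc ?disr // fE // mem_cat urs orbT.
have [hc hr ho exh] := IH g (moves_inj (l := excursion sigma r) finj) un crs nf gE.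
rewrite moves_cat extra_cat -/g; split.
- by rewrite hc gc.
- move=> u; rewrite mem_cat; have [urs _|urs] := boolP (u \in orbits sigma rs).
    exact: hr.
  by rewrite orbF => ur'; rewrite ho ?gr.
- move=> u; rewrite mem_cat negb_or => /andP[ur' urs]; rewrite ho //.
  by have [->|uc] := eqVneq u c; rewrite ?gc // goE.
by rewrite exr exh gc -[(size (r :: rs))%:R]/((size rs).+1%:R) -natr1; ring.
Qed.

(** [tok0 I] conjugates [sigma] to [succ_perm I], which matches cycles of vertices with cycles of
    tokens. *)
Lemma mem_porbit_orbit u v :
  (tok0 I u \in porbit (succ_perm I) (tok0 I v)) = (u \in orbit sigma v).
Proof.
have E i : ((succ_perm I) ^+ i)%g (tok0 I v) = tok0 I (iter i sigma v).
  by rewrite permX; elim: i => //= i ->; rewrite succ_permE.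
rewrite -fconnect_orbit; apply/porbitP/idP => [[i]|uv].
  by rewrite E => /(@tok0_inj _ _ _ I) ->; apply: fconnect_iter.
by exists (findex sigma v u); rewrite E iter_findex.
Qed.

Lemma mem_unlocked u : (tok0 I u \in unlocked_cycle I c) = (u \in orbit sigma c).
Proof. exact: mem_porbit_orbit. Qed.

(** Moving the cycle of the first representative into [S] lowers both sides by one. *)
Lemma locked_transversal (S rs : seq V) : transversal sigma S rs ->
  #|locked_cycles I [set t | ini I t \in S]| = size rs.
Proof.
elim: rs S => [|r rs IH] S [cl un nf cov].
  apply/eqP; rewrite cards_eq0; apply/set0Pn=> -[C]; rewrite inE.
  case: imsetP => //= -[t _ ->]; rewrite card_porbit_gt1 => /andP[st].
  rewrite -setI_eq0 => /eqP/setP/(_ t); rewrite !inE porbit_id /=.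
  have := cov (ini I t); rewrite orbF => -> //.
  apply: contra_neq st => /eqP; rewrite /sigma -(inj_eq (@tok0_inj _ _ _ I)).
  by rewrite -succ_permE iniK => /eqP.
have /= /andP[sr nf'] := nf.
move: un; rewrite -[orbits _ _]/(orbit sigma r ++ orbits sigma rs).
rewrite cat_uniq has_cat negb_or.
case/andP=> /and3P[ur dis un] /andP[rS rsS].
have rNS : r \notin S by apply: contra rS => rS; apply/hasP; exists r; rewrite ?in_orbit.
have clS : orbit_closed I [set t | ini I t \in S].
  move=> t; rewrite inE => tS; apply/subsetP=> t'; rewrite inE.
  by rewrite -{1}[t'](iniK I) -{1}[t](iniK I) mem_porbit_orbit; apply: cl.
rewrite (locked_cyclesU (t := tok0 I r) clS) ?inE ?tok0K //.
have -> : succ_perm I (tok0 I r) != tok0 I r.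
  by rewrite succ_permE (inj_eq (@tok0_inj _ _ _ I)).
rewrite addn1 /= -(IH (orbit sigma r ++ S)).
  congr (#|locked_cycles I _|.+1); apply/setP=> t.
  by rewrite !inE mem_cat -{2}[t](iniK I) mem_porbit_orbit orbC.
split=> //.
- move=> u v; rewrite !mem_cat => /orP[uo|uS] vu.
    by rewrite (mem_orbit_trans vu uo).
  by rewrite (cl _ _ uS vu) orbT.
- rewrite un /=; apply/hasPn=> u urs /=; rewrite mem_cat negb_or.
  by rewrite (hasPn rsS) // andbT; apply: (hasPn dis).
move=> v /cov; rewrite -[orbits _ (_ :: _)]/(orbit sigma r ++ orbits sigma rs) !mem_cat.
by case/or3P=> ->; rewrite ?orbT.
Qed.

(** With the token of [z] on the center, the center takes the place of [z] at the head of the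
    path. *)
Lemma fpath_center f z p : f c = tok0 I z -> {in p, f =1 tok0 I} ->
  fpath (dst \o f) c p = fpath sigma z p.
Proof.
case: p => //= y p fc fE; rewrite fc; congr (_ && _).
by apply: eq_in_fpath => u /mem_belast /fE /= ->.
Qed.

(* The swaps l are made while the token of xv is at the center, and sort all
   leaves outside the unlocked cycle. *)
Lemma moves_unlocked xv l : xv \in orbit sigma c ->
    (forall f, injective f -> f c = tok0 I xv ->
       (forall u, u \notin orbit sigma c -> f u = tok0 I u) ->
     [/\ {in orbit sigma c, moves f l =1 f} &
         forall u, u \notin orbit sigma c -> dst (moves f l u) = u]) ->
  let i := findex sigma c xv in
  let p1 := traject sigma (sigma c) i in
  let p2 := traject sigma (sigma xv) ((fingraph.order sigma c).-1 - i) in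
  exists f, [/\ injective f, f c = tok0 I xv,
    forall u, u \notin orbit sigma c -> f u = tok0 I u,
    forall u, dst (moves (tok0 I) (p1 ++ l ++ p2) u) = u &
    extra (tok0 I) (p1 ++ l ++ p2) = extra f l].
Proof.
move=> xX Hl i p1 p2.
have xE : iter i sigma c = xv by apply: iter_findex; rewrite fconnect_orbit.
have tailE : orbit_tail sigma c = p1 ++ p2 by apply: orbit_tail_split.
have unX : uniq (c :: p1 ++ p2) by rewrite -tailE -orbit_cons orbit_uniq.
have cyc : fpath sigma c (rcons (p1 ++ p2) c).
  by have := cycle_orbit sigma_inj c; rewrite orbit_cons tailE.
have last1 : last c p1 = xv by rewrite /p1 last_traject xE.
move: cyc; rewrite rcons_path cat_path last_cat last1.
case/andP=> /andP[pth1 pth2] /eqP lastc.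
have /= := unX; rewrite mem_cat negb_or cat_uniq => /andP[/andP[c1 c2] /and3P[u1 d12 u2]].
have un1 : uniq (c :: p1) by rewrite /= c1.
have un2 : uniq (c :: p2) by rewrite /= c2.
have [fc fs fo ex1] := moves_walk (@tok0_inj _ _ _ I) pth1 un1.
set f := moves (tok0 I) p1 in fc fs fo; rewrite last1 in fc.
have XE u : (u \in orbit sigma c) = [|| u == c, u \in p1 | u \in p2].
  by rewrite orbit_cons tailE inE mem_cat.
have finj : injective f by apply: moves_inj; apply: tok0_inj.
have fX u : u \notin orbit sigma c -> f u = tok0 I u.
  by rewrite XE !negb_or => /and3P[uc up1 _]; rewrite fo // inE negb_or uc.
have [gX gN] := Hl f finj fc fX; set g := moves f l in gX gN.
have gc : g c = tok0 I xv by rewrite gX ?in_orbit.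
have g2 : {in p2, g =1 tok0 I}.
  move=> u up2; rewrite gX ?XE ?up2 ?orbT // fo // inE negb_or.
  rewrite (memPn c2) //=.
  by apply: contra d12 => up1; apply/hasP; exists u.
have ginj : injective g by apply: moves_inj.
(* The second half of the walk resumes with the token of [xv], which [l] has left on the center. *)
have pth2' : fpath (dst \o g) c p2 by rewrite (fpath_center gc g2).
have [hc hs ho ex2] := moves_walk ginj pth2' un2.
exists f; rewrite !moves_cat !extra_cat -/f -/g ex1 ex2 addr0 add0r; split=> // u.
have [uX|uX] := boolP (u \in orbit sigma c); last first.
  rewrite ho ?gN //; apply: contra uX; rewrite inE XE.
  by case/orP=> ->; rewrite ?orbT.
have := uX; rewrite XE => /or3P[/eqP ->|up1|up2]; last exact: hs.
  (* The cycle closes: the token that reaches the center last is destined for it. *)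
  rewrite hc -[RHS]lastc /sigma; congr (dst _).
  case: (p2) g2 => [|z q] g2 /=; first by rewrite gc.
  by rewrite g2 // mem_last.
rewrite ho ?gX ?fs // inE negb_or (memPn c1) //=.
by apply: contra d12 => up2; apply/hasP; exists u.
Qed.

(** A helper outside the unlocked cycle costs one opening by the token of [xv] and then opens the
    other locked cycles itself. If its own cycle is nontrivial, only [L - 1] remain; if it was
    happy, all [L] remain and moving it away from home counts its weight once more. *)
Lemma schedule_extra xv gv : xv \in orbit sigma c ->
  let L := num_locked I c in
  (forall u, dst (moves (tok0 I) (schedule sigma c xv gv) u) = u) /\
  extra (tok0 I) (schedule sigma c xv gv) =
    if gv \in orbit sigma c then 2 * w (tok0 I xv) * L%:R
    else 2 * w (tok0 I xv) + 2 * w (tok0 I gv) *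
      (if sigma gv == gv then L%:R + 1 else L%:R - 1).
Proof.
move=> xX L; rewrite /schedule.
have clX u v : u \in orbit sigma c -> v \in orbit sigma u -> v \in orbit sigma c.
  by move=> uc vu; apply: mem_orbit_trans vu uc.
have setX : unlocked_cycle I c = [set t | ini I t \in orbit sigma c].
  by apply/setP=> t; rewrite inE -mem_unlocked iniK.
have LE rs : transversal sigma (orbit sigma c) rs -> L = size rs.
  by move=> tr; rewrite -(locked_transversal tr) /L num_lockedE setX.
case: ifPn => gX.
  set rs := scan _ _ _.
  have tr : transversal sigma (orbit sigma c) rs.
    by apply: scan_transversal => //; apply: sigma_inj.
  have [_ /andP[un dis] nf cov] := tr.
  have crs : c \notin orbits sigma rs.
    by apply: contra dis => crs; apply/hasP; exists c; rewrite //= in_orbit.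
  have notX u : u \in orbits sigma rs -> u \notin orbit sigma c.
    by move=> urs; apply: contra dis => uX; apply/hasP; exists u.
  have := moves_unlocked (l := excursions sigma rs) xX; case.
    move=> f finj fc fX.
    have fE : {in orbits sigma rs, f =1 tok0 I} by move=> u /notX /fX.
    have [mc ms mo _] := moves_excursions finj un crs nf fE; split.
      by move=> u uX; apply: mo; apply: contraL uX => /notX.
    move=> u uX; have [/ms //|urs] := boolP (u \in orbits sigma rs).
    rewrite mo // fX //; apply/eqP; apply: contraNT urs => /cov.
    by rewrite (negbTE uX).
  move=> f [finj fc fX srt ->]; split=> //.
  have fE : {in orbits sigma rs, f =1 tok0 I} by move=> u /notX /fX.
  have [_ _ _ ->] := moves_excursions finj un crs nf fE.
  by rewrite fc (LE rs).
set rs := scan _ _ _.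
have clS u v : u \in orbit sigma gv ++ orbit sigma c -> v \in orbit sigma u ->
    v \in orbit sigma gv ++ orbit sigma c.
  rewrite !mem_cat => /orP[] uo vu; first by rewrite (mem_orbit_trans vu uo).
  by rewrite (mem_orbit_trans vu uo) orbT.
have tr : transversal sigma (orbit sigma gv ++ orbit sigma c) rs.
  by apply: scan_transversal => //; apply: sigma_inj.
have [_ /andP[un dis] nf cov] := tr.
have notS u : u \in orbits sigma rs ->
    (u \notin orbit sigma gv) && (u \notin orbit sigma c).
  move=> urs; rewrite -negb_or -mem_cat; apply: contra dis => uX.
  by apply/hasP; exists u.
have crs : c \notin orbits sigma rs.
  by apply/negP=> /notS; rewrite in_orbit andbF.
have LE' : L%:R = (size rs)%:R + (sigma gv != gv)%:R :> R.
  have clXT : orbit_closed I (unlocked_cycle I c) by case: (touched_unlocked I c).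
  have gXT : tok0 I gv \notin unlocked_cycle I c by rewrite mem_unlocked.
  rewrite /L num_lockedE (locked_cyclesU clXT gXT) natrD -(locked_transversal tr).
  rewrite succ_permE (inj_eq (@tok0_inj _ _ _ I)); congr (_%:R + _).
  congr #|locked_cycles I _|; apply/setP=> t; rewrite !inE mem_cat -{1 2}[t](iniK I).
  by rewrite mem_unlocked mem_porbit_orbit orbC.
have gNX u : u \in orbit sigma gv -> u \notin orbit sigma c.
  move=> ug; apply: contra gX => uX; apply: clX uX _.
  by rewrite mem_orbit_sym //; apply: sigma_inj.
have gc : gv != c by apply: contraNneq gX => ->; rewrite in_orbit.
have ung : uniq [:: c, gv & orbit_tail sigma gv].
  rewrite -orbit_cons cons_uniq orbit_uniq andbT.
  by apply/negP=> /gNX; rewrite in_orbit.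
(* The excursions are nested inside the opened cycle of [gv], whose closing walk comes last. *)
have inner f : injective f -> f c = tok0 I xv ->
       (forall u, u \notin orbit sigma c -> f u = tok0 I u) ->
  let l := gv :: excursions sigma rs ++ rcons (orbit_tail sigma gv) gv in
  [/\ {in orbit sigma c, moves f l =1 f},
      forall u, u \notin orbit sigma c -> dst (moves f l u) = u &
      extra f l = 2 * w (f c) + 2 * (w (f gv) * (sigma gv == gv)%:R) +
           2 * w (f gv) * (size rs)%:R].
  move=> finj fc fX l.
  have [hc hg ho] := swapE f gv; set h := swap f (c, gv) in hc hg ho.
  have hinj : injective h by apply: swap_inj.
  have hE : {in orbits sigma rs, h =1 tok0 I}.
    move=> u urs; have /andP[ug uc] := notS u urs; rewrite ho ?fX //.
      by apply: contraNneq uc => ->; rewrite in_orbit.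
    by apply: contraNneq ug => ->; rewrite in_orbit.
  have [mc ms mo exm] := moves_excursions hinj un crs nf hE.
  have fEg : {in orbit sigma gv, f =1 tok0 I} by move=> u /gNX /fX.
  have same : {in [:: c, gv & orbit_tail sigma gv],
      moves h (excursions sigma rs) =1 h}.
    rewrite -orbit_cons => u; rewrite inE => ucg; apply: mo.
    by apply: contraL ucg => /notS/andP[ug uc]; rewrite negb_or ug andbT;
      apply: contraNneq uc => ->; rewrite in_orbit.
  have [nc ns no ->] := moves_nested finj (fcycle_orbit fEg) ung same.
  rewrite -orbit_cons in ns no.
  split.
  - move=> u uX; have [->//|uc] := eqVneq u c.
    have ug : u \notin orbit sigma gv by apply: contraL uX => /gNX.
    rewrite no ?inE ?negb_or ?uc // mo.
      by rewrite ho //; apply: contraNneq ug => ->; rewrite in_orbit.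
    by apply: contraL uX => /notS/andP[].
  - move=> u uX; have [/ns //|ug] := boolP (u \in orbit sigma gv).
    have uc : u != c by apply: contraNneq uX => ->; rewrite in_orbit.
    rewrite no ?inE ?negb_or ?uc //; have [/ms //|urs] := boolP (u \in orbits sigma rs).
    rewrite mo // ho // ?fX //; last by apply: contraNneq ug => ->; rewrite in_orbit.
    apply/eqP; apply: contraNT urs => /cov.
    by rewrite mem_cat (negbTE uX) (negbTE ug).
  by rewrite orbit_tail_nil ?exm ?hc //; apply: sigma_inj.
have := moves_unlocked
  (l := gv :: excursions sigma rs ++ rcons (orbit_tail sigma gv) gv) xX.
case=> [f finj fc fX|f [finj fc fX srt ->]]; first by have [] := inner f finj fc fX.
split=> //; have [_ _ ->] := inner f finj fc fX.
by rewrite fc fX // LE'; case: eqP => _ /=; ring.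
Qed.

Lemma mem_excursions rs u :
  (u \in excursions sigma rs) = (u \in orbits sigma rs).
Proof.
elim: rs => // r rs IH.
rewrite -[excursions _ _]/(excursion sigma r ++ excursions sigma rs).
rewrite -[orbits _ (_ :: _)]/(orbit sigma r ++ orbits sigma rs) !mem_cat IH.
by rewrite orbit_cons /excursion inE mem_rcons inE orbA orbb.
Qed.

(** Swapping the center with itself is not an edge, so the schedule must consist of leaves for its
    swaps to be legal. *)
Lemma center_notin_schedule xv gv : xv \in orbit sigma c ->
  c \notin schedule sigma c xv gv.
Proof.
move=> xX; rewrite /schedule; set i := findex _ _ _; set p1 := traject _ _ i.
set p2 := traject _ _ (_ - _); set l := (if _ then _ else _).
have tailE : orbit_tail sigma c = p1 ++ p2 by apply: orbit_tail_split.
have := orbit_uniq sigma c; rewrite orbit_cons tailE => /andP[cp _].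
rewrite mem_cat negb_or mem_cat negb_or andbCA -negb_or -mem_cat cp andbT.
rewrite {}/l; case: ifPn => gX.
  rewrite mem_excursions.
  have [|_ /andP[_ dis] _ _] := @scan_transversal _ sigma sigma_inj (orbit sigma c).
    by move=> u v uc vu; apply: mem_orbit_trans vu uc.
  by apply: contra dis => cr; apply/hasP; exists c; rewrite //= in_orbit.
have [|_ /andP[_ dis] _ _] :=
    @scan_transversal _ sigma sigma_inj (orbit sigma gv ++ orbit sigma c).
  move=> u v; rewrite !mem_cat => /orP[] uo vu.
    by rewrite (mem_orbit_trans vu uo).
  by rewrite (mem_orbit_trans vu uo) orbT.
rewrite inE mem_cat mem_excursions mem_rcons -orbit_cons.
apply: contra dis => /or3P[/eqP E| |cg].
- by rewrite -E in_orbit in gX.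
- by move=> cr; apply/hasP; exists c; rewrite //= mem_cat in_orbit orbT.
by rewrite mem_orbit_sym ?cg in gX; last exact: sigma_inj.
Qed.

(** The truncated predecessor gives [0] rather than [-1] when nothing is locked; natural factors are
    what the program can compute. *)
Definition helper_key v : R :=
  w (tok0 I v) * (if (v != c) && (sigma v == v) then (num_locked I c).+1
                  else (num_locked I c).-1)%:R.

Hypothesis star : is_star (edge I) c.

Lemma schedule_value xv gv (x a : T) (oh : option T) :
    xv \in orbit sigma c ->
    {in orbit sigma c, forall v, w (tok0 I xv) <= w (tok0 I v)} ->
    (forall v, helper_key gv <= helper_key v) ->
    min_token I (unlocked_cycle I c) x -> min_token I (Aset I) a ->
    min_token_opt I (Hset I) oh ->
  Dw I + extra (tok0 I) (schedule sigma c xv gv) = star_value I c x a oh.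
Proof.
move=> xX le_xv le_g [x_X le_x] [aA le_a] Hoh.
have wx : w (tok0 I xv) = w x.
  apply/le_anti; rewrite le_x ?mem_unlocked // andbT.
  by rewrite -[x](iniK I); apply: le_xv; rewrite -mem_unlocked iniK.
have [_ ->] := schedule_extra gv xX; rewrite wx.
have AE v : (tok0 I v \in Aset I) = ~~ ((v != c) && (sigma v == v)).
  by rewrite inE (tok0_Hset star).
have a_key : helper_key (ini I a) = w a * (num_locked I c).-1%:R.
  by rewrite /helper_key iniK; move: aA; rewrite -{1}[a](iniK I) AE => /negbTE ->.
have wa_gt0 := weight_gt0 I a; have wg_gt0 := weight_gt0 I (tok0 I gv).
have := le_g (ini I a); rewrite a_key; have := le_g c; rewrite /helper_key eqxx /=.
(* With no locked cycle the key of [c] is [0], so a best helper cannot be happy and lies in the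
   unlocked cycle; the schedule then has no extra. *)
case: (posnP (num_locked I c)) => [l0|l_gt0].
  rewrite l0 !mulr0; have AX := Aset_no_locked star l0.
  case: ifPn => [_|+ _ _]; first by rewrite leNgt mulr1 wg_gt0.
  rewrite -AE AX mem_unlocked => ->.
  have wxa : w x = w a by apply/le_anti; rewrite le_x -?AX // le_a // AX.
  rewrite /star_value l0 wxa; case: oh {Hoh} => [h|]; last by lra.
  by rewrite min_l; have := weight_gt0 I h; lra.
move=> _; set L : R := (num_locked I c)%:R.
have predL : (num_locked I c).-1%:R = L - 1 by rewrite -subn1 natrB.
have L1_ge0 : 0 <= L - 1 by rewrite -predL ler0n.
have succL : (num_locked I c).+1%:R = L + 1 by rewrite -natr1.
have XA : gv \in orbit sigma c -> tok0 I gv \in Aset I.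
  by rewrite -mem_unlocked; apply/subsetP/unlocked_sub_Aset.
have hkey (h : T) : h \in Hset I -> helper_key (ini I h) = w h * (L + 1).
  move=> hH; rewrite /helper_key iniK.
  by have := tok0_Hset star (ini I h); rewrite iniK hH /sigma iniK => <-; rewrite succL.
case: ifPn => [gh|gh]; last first.
  have gA : tok0 I gv \in Aset I by rewrite AE.
  rewrite predL => le_ga; have le_ag := le_a _ gA.
  (* Only the products are equal: for [L = 1] the weights may differ. *)
  have ga : w (tok0 I gv) * (L - 1) = w a * (L - 1).
    by apply/le_anti; rewrite le_ga ler_wpM2r.
  have value : star_value I c x a oh = Dw I + 2 * w x + 2 * (w a * (L - 1)).
    rewrite /star_value -/L; case: oh Hoh => [h [hH _]|//]; rewrite min_l // -ga.
    have := le_g (ini I h); rewrite hkey // /helper_key.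
    by rewrite (negbTE gh) predL.
  rewrite value; case: ifPn => gX.
    (* For a helper in the unlocked cycle, [w x] lies between [w a] and the weight of the helper, so
       [x] gives the same product with [L - 1]. *)
    have wxg : w x <= w (tok0 I gv) by apply: le_x; rewrite mem_unlocked.
    have wax : w a <= w x.
      by apply: le_a; apply: (subsetP (unlocked_sub_Aset star)).
    have := ler_wpM2r L1_ge0 wxg; have := ler_wpM2r L1_ge0 wax.
    by rewrite ga; lra.
  have gc : gv != c by apply: contraNneq gX => ->; rewrite in_orbit.
  by move: gh; rewrite gc /= => /negbTE ->; rewrite -ga; lra.
rewrite predL succL => le_ga.
have gH : tok0 I gv \in Hset I by rewrite (tok0_Hset star).
have /negbTE -> : gv \notin orbit sigma c.
  by apply: contraL gH => /XA; rewrite inE.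
have /andP[_ ->] := gh.
case: oh Hoh => [h [hH le_h]|H0]; last by rewrite H0 inE in gH.
(* All happy leaves share the factor [L + 1], so a best key among them belongs to a lightest happy
   token. *)
have gh_eq : w (tok0 I gv) = w h.
  apply/le_anti; rewrite le_h // andbT.
  have := le_g (ini I h); rewrite hkey // /helper_key gh succL ler_pM2r //.
  by lra.
rewrite /star_value -/L min_r -?gh_eq //; lra.
Qed.

Lemma schedule_optimal xv gv :
    xv \in orbit sigma c ->
    {in orbit sigma c, forall v, w (tok0 I xv) <= w (tok0 I v)} ->
    (forall v, helper_key gv <= helper_key v) ->
  let s := center_swaps (schedule sigma c xv gv) in
  sorting I s /\ forall (x a : T) (oh : option T),
    min_token I (unlocked_cycle I c) x -> min_token I (Aset I) a ->
    min_token_opt I (Hset I) oh -> cost I s = star_value I c x a oh.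
Proof.
move=> xX le_xv le_g s; have [srt _] := schedule_extra gv xX.
split; last first.
  move=> x a oh xm am hm; rewrite -(schedule_value xX le_xv le_g xm am hm).
  (* A sorted configuration has potential zero, so the cost is [Dw] plus the extra. *)
  rewrite (Dw_potential star) /extra (potential_sorted c srt) addr0.
  by rewrite addrC subrK.
split=> //; apply/allP=> _ /mapP[v vs ->] /=; rewrite (star_edgeE star) eqxx andbT.
by apply: contraTneq vs => <-; apply: center_notin_schedule.
Qed.

Lemma star_min_cost (x a : T) (oh : option T) :
    min_token I (unlocked_cycle I c) x -> min_token I (Aset I) a ->
    min_token_opt I (Hset I) oh ->
  is_min_sorting_cost I (star_value I c x a oh).
Proof.
move=> xm am hm; split; last exact: star_lower_bound.
have [x_X le_x] := xm.
have xX : ini I x \in orbit sigma c by rewrite -mem_unlocked iniK.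
have le_xv : {in orbit sigma c, forall v, w (tok0 I (ini I x)) <= w (tok0 I v)}.
  by move=> v vX; rewrite iniK le_x // mem_unlocked.
pose gv := [arg min_(v < c) helper_key v]%O.
have le_g v : helper_key gv <= helper_key v.
  by rewrite /gv; case: arg_minP => // u _; apply.
have [srt val] := schedule_optimal xX le_xv le_g.
by eexists; split; [apply: srt | apply: val].
Qed.

End ScheduleCost.

(** * Time accounting for random access programs *)

Fixpoint esize (e : expr) : nat :=
  match e with
  | Const _ => 1
  | Mem e1 | Inp e1 => (esize e1).+1
  | Add e1 e2 | Sub e1 e2 | Mul e1 e2 => (esize e1 + esize e2).+1
  end.

(** The bound 8 is the memory offset of the marks, the largest constant in the program. *)
Fixpoint small_consts (e : expr) : bool :=
  match e with
  | Const k => k <= 8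
  | Mem e1 | Inp e1 => small_consts e1
  | Add e1 e2 | Sub e1 e2 | Mul e1 e2 => small_consts e1 && small_consts e2
  end.

(** The cap 128 is large enough for every expression of the program and is checked by
    computation. *)
Definition small_expr (e : expr) : bool := small_consts e && (esize e <= 128).

Lemma bits_leq (n j : nat) : 0 < j -> n < 2 ^ j -> bits n <= j.
Proof.
move=> j_gt0; rewrite /bits; case: n => [|n] lt_n; first by rewrite trunc_log0.
rewrite -(ltn_exp2l _ _ (isT : 1 < 2)).
exact: leq_ltn_trans (trunc_logP _ _) lt_n.
Qed.

Lemma ltn_bits (n : nat) : n < 2 ^ bits n.
Proof. exact: trunc_log_ltn. Qed.

Section Run.
Variables (inp : seq nat) (K : nat).
Hypothesis K_gt3 : 3 < K.
Hypothesis inp_lt : forall i, nth 0 inp i < 2 ^ K.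

Definition bounded_mem (m : mem_state) : Prop := forall i, m i < 2 ^ K.

Lemma esize_gt0 e : 0 < esize e. Proof. by case: e. Qed.

(** Sums, differences and products are at most [x * y + x + y], one less than [(x + 1) * (y + 1)],
    so bit lengths add up over the nodes. *)
Lemma eval_lt m e : bounded_mem m -> small_consts e ->
  eval inp m e < 2 ^ (K * esize e).
Proof.
move=> bm.
have up k j : k < 2 ^ K -> 0 < j -> k < 2 ^ (K * j).
  by move=> lt_k j_gt0; apply: leq_trans lt_k _; rewrite leq_exp2l // leq_pmulr.
have bin x y a b : x < 2 ^ (K * a) -> y < 2 ^ (K * b) ->
    x * y + x + y < 2 ^ (K * (a + b).+1).
  move=> lt_x lt_y; have := leq_mul lt_x lt_y; rewrite -expnD -mulnDr => le_xy.
  apply: (@leq_trans (2 ^ (K * (a + b)))); last first.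
    by rewrite leq_exp2l // leq_mul2l leqnSn orbT.
  by apply: leq_trans le_xy; nia.
elim: e => [k|e IH|e IH|e1 IH1 e2 IH2|e1 IH1 e2 IH2|e1 IH1 e2 IH2] /=.
- move=> k8; apply: up => //; apply: (@leq_ltn_trans 8) => //.
  by apply: (@leq_trans (2 ^ 4)) => //; rewrite leq_exp2l.
- by move=> _; apply: up.
- by move=> _; apply: up.
all: by case/andP=> /IH1 lt1 /IH2 lt2; apply: leq_ltn_trans (bin _ _ _ _ lt1 lt2); lia.
Qed.

Lemma ecost_leq m e : bounded_mem m -> small_consts e ->
  ecost inp m e <= K * esize e * esize e.
Proof.
move=> bm; have b_le e' : small_consts e' -> bits (eval inp m e') <= K * esize e'.
  move=> sc; apply: bits_leq; last exact: eval_lt.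
  by rewrite muln_gt0 esize_gt0 (ltn_trans _ K_gt3).
elim: e => [k|e IH|e IH|e1 IH1 e2 IH2|e1 IH1 e2 IH2|e1 IH1 e2 IH2] sc;
  have := b_le _ sc; move: sc => /=.
- by rewrite !muln1 addn0.
- by move=> /IH; set b := bits _; nia.
- by move=> /IH; set b := bits _; nia.
all: by case/andP=> /IH1 le1 /IH2 le2; set b := bits _; nia.
Qed.

(** Pays for one command together with at most two small expressions. *)
Definition time_unit : nat := (2 * (K * 128 * 128)).+1.

Lemma small_ecost m e : bounded_mem m -> small_expr e ->
  ecost inp m e <= K * 128 * 128.
Proof.
move=> bm /andP[sc sz]; apply: leq_trans (ecost_leq bm sc) _.
by rewrite !leq_mul.
Qed.

(** Time is measured in units, so that the later bounds only count steps and bit lengths do not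
    enter. *)
Definition run (p : cmd) (s s' : state) (k : nat) : Prop :=
  exists2 t, exec inp p s s' t & t <= time_unit * k.

Lemma run_leq p s s' k k' : run p s s' k -> k <= k' -> run p s s' k'.
Proof.
case=> t ex le_t le_k; exists t => //; apply: leq_trans le_t _.
by rewrite leq_mul2l le_k orbT.
Qed.

Lemma run_skip s : run Skip s s 1.
Proof. by exists 1; [apply: ExecSkip | rewrite muln1]. Qed.

Lemma run_store m o e1 e2 : bounded_mem m -> small_expr e1 -> small_expr e2 ->
  run (Store e1 e2) (m, o) (update m (eval inp m e1) (eval inp m e2), o) 1.
Proof.
move=> bm s1 s2; eexists; first exact: ExecStore.
have := small_ecost bm s1; have := small_ecost bm s2; rewrite /time_unit.
set b := K * 128 * 128; set x := ecost _ _ _; set y := ecost _ _ _; lia.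
Qed.

Lemma run_output m o e : bounded_mem m -> small_expr e ->
  run (Output e) (m, o) (m, rcons o (eval inp m e)) 1.
Proof.
move=> bm s1; eexists; first exact: ExecOutput.
have := small_ecost bm s1; rewrite /time_unit.
set b := K * 128 * 128; set x := ecost _ _ _; lia.
Qed.

Lemma run_seq p1 p2 s1 s2 s3 k1 k2 :
  run p1 s1 s2 k1 -> run p2 s2 s3 k2 -> run (Seq p1 p2) s1 s3 (k1 + k2).
Proof.
move=> [t1 ex1 le1] [t2 ex2 le2]; exists (t1 + t2); first exact: ExecSeq ex1 ex2.
by rewrite mulnDr leq_add.
Qed.

Lemma run_if e p1 p2 s s' k : bounded_mem s.1 -> small_expr e ->
  run (if eval inp s.1 e != 0 then p1 else p2) s s' k -> run (If e p1 p2) s s' k.+1.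
Proof.
move=> bm se [t ex le_t]; exists (1 + ecost inp s.1 e + t).
  case: ifPn ex => [ne|]; first exact: ExecIfTrue.
  by rewrite negbK => /eqP; apply: ExecIfFalse.
have := small_ecost bm se; rewrite [time_unit * _]mulnS {1}/time_unit.
by set b := K * 128 * 128; set x := ecost _ _ _; move: le_t; set y := _ * k; lia.
Qed.

Lemma run_while_stop e p s : bounded_mem s.1 -> small_expr e ->
  eval inp s.1 e = 0 -> run (While e p) s s 1.
Proof.
move=> bm se e0; eexists; first exact: ExecWhileFalse.
have := small_ecost bm se; rewrite /time_unit.
set b := K * 128 * 128; set x := ecost _ _ _; lia.
Qed.

Lemma run_while_step e p s1 s2 s3 k1 k2 : bounded_mem s1.1 -> small_expr e ->
  eval inp s1.1 e != 0 -> run p s1 s2 k1 -> run (While e p) s2 s3 k2 ->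
  run (While e p) s1 s3 (k1 + k2).+1.
Proof.
move=> bm se ne [t1 ex1 le1] [t2 ex2 le2].
eexists; first exact: ExecWhileTrue ne ex1 ex2.
have := small_ecost bm se; rewrite [time_unit * _]mulnS mulnDr {1}/time_unit.
set b := K * 128 * 128; set x := ecost _ _ _.
by move: le1 le2; set y := _ * k1; set z := _ * k2; lia.
Qed.

End Run.

(** * The program computing the schedule *)

(* Memory layout: cell 0 is the walker r, cell 1 the scanned vertex v, cells 2
   and 3 the vertices x and g of the tokens chosen by the schedule, cell 4 a
   cycle counter l, and cell 8 + u the mark of vertex u. *)
Definition layout (r v x g l : nat) (M : nat -> nat) : mem_state := fun j =>
  match j with
  | 0 => r | 1 => v | 2 => x | 3 => g | 4 => l | 5 | 6 | 7 => 0
  | j'.+4.+4 => M j'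
  end.

Local Notation eR := (Mem (Const 0)).
Local Notation eV := (Mem (Const 1)).
Local Notation eX := (Mem (Const 2)).
Local Notation eG := (Mem (Const 3)).
Local Notation eL := (Mem (Const 4)).
Local Notation eN := (Inp (Const 0)).
Local Notation eC := (Inp (Const 1)).

Definition mark_of (e : expr) : expr := Mem (Add (Const 8) e).

(** Subtraction is truncated, so the sum of both differences vanishes only at equality. *)
Definition neq (e1 e2 : expr) : expr := Add (Sub e1 e2) (Sub e2 e1).

(** After two header entries the input has four blocks of length [n]: tokens by vertex, then
    destinations, numerators and denominators by token. Data of a vertex are therefore reached
    through its token. *)
Definition token_of (e : expr) : expr := Inp (Add (Const 2) e).

Definition sigma_of (e : expr) : expr := Inp (Add (Add (Const 2) eN) (token_of e)).

Definition num_of (e : expr) : expr :=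
  Inp (Add (Add (Const 2) (Mul (Const 2) eN)) (token_of e)).

Definition den_of (e : expr) : expr :=
  Inp (Add (Add (Const 2) (Mul (Const 3) eN)) (token_of e)).

Definition set_mark (k : nat) (e : expr) : cmd :=
  if k is 0 then Skip else Store (Add (Const 8) e) (Const k).

Definition emit (em : bool) (e : expr) : cmd :=
  if em then Seq (Output eC) (Output e) else Skip.

(* In the commands below, marks are set to k unless k = 0, and swaps are output
   only if em holds. *)
Definition walk (k : nat) (em : bool) (stop : expr) : cmd :=
  While (neq eR stop)
    (Seq (set_mark k eR) (Seq (emit em eR) (Store (Const 0) (sigma_of eR)))).

Definition walk_cycle (k : nat) (em : bool) (e : expr) : cmd :=
  Seq (set_mark k e) (Seq (Store (Const 0) (sigma_of e)) (walk k em e)).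

Definition for_vertices (body : cmd) : cmd :=
  Seq (Store (Const 1) (Const 0))
      (While (Sub eN eV) (Seq body (Store (Const 1) (Add eV (Const 1))))).

Definition scan_cycles (k : nat) (em : bool) : cmd :=
  for_vertices
    (If (Mul (neq (mark_of eV) (Const k)) (neq (sigma_of eV) eV))
       (Seq (emit em eV) (Seq (walk_cycle k em eV)
          (Seq (emit em eV) (Store (Const 4) (Add eL (Const 1))))))
       Skip).

Definition argmin (dst : nat) (cond : expr) : cmd :=
  Seq (Store (Const dst) eC) (for_vertices (If cond (Store (Const dst) eV) Skip)).

(** Fractions are compared by cross-multiplication; truncated subtraction is nonzero exactly on
    strict improvement, and the mark restricts the search to the unlocked cycle. *)
Definition lighter : expr :=
  Mul (mark_of eV) (Sub (Mul (num_of eX) (den_of eV)) (Mul (num_of eV) (den_of eX))).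

(* Marks are 0 exactly on happy leaves when this is evaluated. *)
Definition key_of (e : expr) : expr :=
  Mul (num_of e) (Add (Mul (mark_of e) (Sub eL (Const 1)))
                      (Mul (Sub (Const 1) (mark_of e)) (Add eL (Const 1)))).

Definition better_helper : expr :=
  Sub (Mul (key_of eG) (den_of eV)) (Mul (key_of eV) (den_of eG)).

(** A silent pass with mark 1 finds [x], counts the locked cycles and finds [g]. The output pass
    overwrites with mark 2, so the old marks need no clearing. *)
Definition star_program : cmd :=
  Seq (walk_cycle 1 false eC)
 (Seq (argmin 2 lighter)
 (Seq (scan_cycles 1 false)
 (Seq (argmin 3 better_helper)
 (Seq (walk_cycle 2 false eC)
 (Seq (Store (Const 0) (sigma_of eC))
 (Seq (walk 0 true (sigma_of eX))
 (Seq (If (neq (mark_of eG) (Const 2))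
         (Seq (walk_cycle 2 false eG)
         (Seq (emit true eG)
         (Seq (scan_cycles 2 true)
         (Seq (Store (Const 0) (sigma_of eG))
         (Seq (walk 0 true eG)
              (emit true eG))))))
         (scan_cycles 2 true))
 (Seq (Store (Const 0) (sigma_of eX))
      (walk 0 true eC))))))))).

Lemma eval_Mul (inp : seq nat) m e1 e2 :
  eval inp m (Mul e1 e2) = eval inp m e1 * eval inp m e2.
Proof. by []. Qed.

Lemma eval_Add (inp : seq nat) m e1 e2 :
  eval inp m (Add e1 e2) = eval inp m e1 + eval inp m e2.
Proof. by []. Qed.

Lemma eval_Sub (inp : seq nat) m e1 e2 :
  eval inp m (Sub e1 e2) = eval inp m e1 - eval inp m e2.
Proof. by []. Qed.

Lemma neq_eq0 (inp : seq nat) m e1 e2 :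
  (eval inp m (neq e1 e2) != 0) = (eval inp m e1 != eval inp m e2).
Proof. by rewrite /=; lia. Qed.

Lemma enc_swaps_cat n (s1 s2 : seq ('I_n * 'I_n)) :
  enc_swaps (s1 ++ s2) = enc_swaps s1 ++ enc_swaps s2.
Proof. by rewrite /enc_swaps map_cat flatten_cat. Qed.

Lemma nth_enum_map n (f : 'I_n -> nat) (s : seq nat) (v : 'I_n) :
  nth 0 ([seq f u | u <- enum 'I_n] ++ s) v = f v.
Proof.
rewrite nth_cat size_map size_enum_ord ltn_ord (nth_map v) ?size_enum_ord //.
by rewrite nth_ord_enum.
Qed.

Lemma nth_enum_cat n (f : 'I_n -> nat) (s : seq nat) k :
  nth 0 ([seq f u | u <- enum 'I_n] ++ s) (n + k) = nth 0 s k.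
Proof. by rewrite nth_cat size_map size_enum_ord ltnNge leq_addr addKn. Qed.

(** * Simulation of the program and its number of steps *)

Section Simulation.
Variables (n : nat) (c : 'I_n) (sg : 'I_n -> 'I_n) (num den : 'I_n -> nat).
Variables (inp : seq nat) (K : nat).
Hypothesis sg_inj : injective sg.
Hypothesis K_gt3 : 3 < K.
Hypothesis inp_lt : forall i, nth 0 inp i < 2 ^ K.
Hypothesis n_lt : n.*2.+2 < 2 ^ K.
Hypothesis inp0 : nth 0 inp 0 = n.
Hypothesis inp1 : nth 0 inp 1 = c.
Hypothesis inp_sg : forall u : 'I_n, nth 0 inp (2 + n + nth 0 inp (2 + u)) = sg u.
Hypothesis inp_num :
  forall u : 'I_n, nth 0 inp (2 + 2 * n + nth 0 inp (2 + u)) = num u.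
Hypothesis inp_den :
  forall u : 'I_n, nth 0 inp (2 + 3 * n + nth 0 inp (2 + u)) = den u.

Notation run := (run inp K).
Notation ev := (eval inp).

Lemma eval_sigma m e (u : 'I_n) : ev m e = u -> ev m (sigma_of e) = sg u.
Proof. by move=> /= ->; rewrite inp0 inp_sg. Qed.

Lemma eval_num m e (u : 'I_n) : ev m e = u -> ev m (num_of e) = num u.
Proof. by move=> /= ->; rewrite inp0 inp_num. Qed.

Lemma eval_den m e (u : 'I_n) : ev m e = u -> ev m (den_of e) = den u.
Proof. by move=> /= ->; rewrite inp0 inp_den. Qed.

(** The bound [n.*2] accommodates the counter in cell 4, which keeps growing through both scans. *)
Definition bounded (r v x g l : nat) (M : nat -> nat) : Prop :=
  [/\ r <= n.*2, v <= n.*2, x <= n.*2, g <= n.*2 & l <= n.*2] /\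
  forall u, M u <= 2.

Lemma bounded_layout r v x g l M : bounded r v x g l M ->
  bounded_mem K (layout r v x g l M).
Proof.
case=> -[le_r le_v le_x le_g le_l] le_M.
have lt k : k <= n.*2.+2 -> k < 2 ^ K by move=> le_k; apply: leq_ltn_trans n_lt.
case=> [|[|[|[|[|[|[|[|j]]]]]]]] //=; apply: lt => //; try lia.
by apply: leq_trans (le_M j) _.
Qed.

Lemma update_layout r v x g l M y :
  [/\ update (layout r v x g l M) 0 y = layout y v x g l M,
      update (layout r v x g l M) 1 y = layout r y x g l M,
      update (layout r v x g l M) 2 y = layout r v y g l M,
      update (layout r v x g l M) 3 y = layout r v x y l M &
      update (layout r v x g l M) 4 y = layout r v x g y M /\
      forall u, update (layout r v x g l M) (8 + u) y = layout r v x g l (update M u y)].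
Proof.
split; [| | | |split=> [|u]]; apply: functional_extensionality.
all: by case=> [|[|[|[|[|[|[|[|j]]]]]]]].
Qed.

Definition mark (M : nat -> nat) (k : nat) (p : seq 'I_n) : nat -> nat :=
  fun u => if (0 < k) && (u \in [seq val z | z <- p]) then k else M u.

Lemma markE M k p (u : 'I_n) : 0 < k -> mark M k p u = if u \in p then k else M u.
Proof. by rewrite /mark => ->; rewrite mem_map //; apply: val_inj. Qed.

Lemma mark_cat M k p q : mark (mark M k p) k q = mark M k (p ++ q).
Proof.
apply: functional_extensionality => u; rewrite /mark map_cat mem_cat.
by case: (0 < k) (u \in _) (u \in _) => [] [] [].
Qed.

Lemma mark_nil M k : mark M k [::] = M.
Proof. by apply: functional_extensionality => u; rewrite /mark andbF. Qed.

Lemma mark_le2 M k p : (forall u, M u <= 2) -> k <= 2 -> forall u, mark M k p u <= 2.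
Proof. by move=> le_M le_k u; rewrite /mark; case: ifP. Qed.

Definition emitted (em : bool) (p : seq 'I_n) : seq nat :=
  if em then enc_swaps (center_swaps c p) else [::].

Lemma emitted_cat em p q : emitted em (p ++ q) = emitted em p ++ emitted em q.
Proof.
by case: em => //=; rewrite /center_swaps map_cat enc_swaps_cat.
Qed.

Lemma run_set_mark k e (u : 'I_n) r v x g l M o :
    bounded r v x g l M -> k <= 2 -> small_expr (Add (Const 8) e) ->
    ev (layout r v x g l M) e = u ->
  run (set_mark k e) (layout r v x g l M, o)
      (layout r v x g l (mark M k [:: u]), o) 1.
Proof.
move=> bd k2 se eu; case: k k2 => [|k] k2; first exact: run_skip.
have := @run_store inp K K_gt3 inp_lt (layout r v x g l M) o
  (Add (Const 8) e) (Const k.+1) (bounded_layout bd) se.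
rewrite /= eu; have [_ _ _ _ [_ ->]] := update_layout r v x g l M k.+1.
have -> : mark M k.+1 [:: u] = update M u k.+1.
  by apply: functional_extensionality => z; rewrite /mark /update /= inE.
by apply; rewrite /small_expr /= andbT (leq_trans k2).
Qed.

Lemma run_emit em e (u : 'I_n) r v x g l M o :
    bounded r v x g l M -> small_expr e -> ev (layout r v x g l M) e = u ->
  run (emit em e) (layout r v x g l M, o)
      (layout r v x g l M, o ++ emitted em [:: u]) 2.
Proof.
move=> /bounded_layout bd se eu; case: em; rewrite /emitted; last first.
  by rewrite cats0; apply: run_leq (run_skip _ _ _) _.
have -> : o ++ enc_swaps (center_swaps c [:: u]) = rcons (rcons o c) u.
  by rewrite -!cats1 -catA.
have ro := @run_output inp K K_gt3 inp_lt (layout r v x g l M).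
by apply: run_seq (ro _ eC bd isT) _; rewrite /= inp1 -eu; apply: ro.
Qed.

Lemma step_while e p r v x g l M o s2 s3 k1 k2 :
    bounded r v x g l M -> small_expr e -> ev (layout r v x g l M) e != 0 ->
    run p (layout r v x g l M, o) s2 k1 -> run (While e p) s2 s3 k2 ->
  run (While e p) (layout r v x g l M, o) s3 (k1 + k2).+1.
Proof.
move=> /bounded_layout bd se ne; exact: (@run_while_step _ _ K_gt3 inp_lt _ _ (_, _)).
Qed.

Lemma stop_while e p r v x g l M o :
    bounded r v x g l M -> small_expr e -> ev (layout r v x g l M) e = 0 ->
  run (While e p) (layout r v x g l M, o) (layout r v x g l M, o) 1.
Proof.
move=> /bounded_layout bd se e0; exact: (@run_while_stop _ _ K_gt3 inp_lt _ _ (_, _)).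
Qed.

Lemma step_if e p1 p2 r v x g l M o s' k :
    bounded r v x g l M -> small_expr e ->
    run (if ev (layout r v x g l M) e != 0 then p1 else p2)
        (layout r v x g l M, o) s' k ->
  run (If e p1 p2) (layout r v x g l M, o) s' k.+1.
Proof.
move=> /bounded_layout bd se; exact: (@run_if _ _ K_gt3 inp_lt _ _ _ (_, _)).
Qed.

Lemma run_set_r e y r v x g l M o : bounded r v x g l M -> small_expr e ->
    ev (layout r v x g l M) e = y ->
  run (Store (Const 0) e) (layout r v x g l M, o) (layout y v x g l M, o) 1.
Proof.
move=> bd se <-; set z := ev _ _.
have [<- _ _ _ _] := update_layout r v x g l M z.
by apply: run_store => //; apply: bounded_layout.
Qed.

Lemma ord_le2 (u : 'I_n) : u <= n.*2.
Proof. by rewrite -addnn (leq_trans (ltnW (ltn_ord u))) ?leq_addr. Qed.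

(** Each turn takes five units: the test, the mark, two for the output, and the assignment. The
    final failing test adds one. *)
Lemma run_walk k em stop (u z : 'I_n) j v x g l M o :
    bounded u v x g l M -> k <= 2 -> small_expr (neq eR stop) ->
    (forall r M', ev (layout r v x g l M') stop = z) ->
    iter j sg u = z -> z \notin traject sg u j ->
  run (walk k em stop) (layout u v x g l M, o)
      (layout z v x g l (mark M k (traject sg u j)),
       o ++ emitted em (traject sg u j)) (5 * j).+1.
Proof.
move=> bd k2 ss Hstop; elim: j u M o bd => [|j IH] u M o bd.
  move=> /= uz _; rewrite -uz mark_nil (_ : emitted em [::] = [::]); last by case: em.
  rewrite cats0 muln0; apply: stop_while => //.
  by apply/eqP/negPn; rewrite neq_eq0 Hstop -uz /= eqxx.
rewrite iterSr trajectS inE negb_or => zE /andP[zu zj].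
have [[le_u le_v le_x le_g le_l] le_M] := bd.
pose M1 := mark M k [:: u].
have le_M1 : forall y, M1 y <= 2 by apply: mark_le2.
have bd1 : bounded u v x g l M1 by [].
have bd2 : bounded (sg u) v x g l M1 by split=> //; split=> //; apply: ord_le2.
have := IH (sg u) M1 (o ++ emitted em [:: u]) bd2 zE zj.
rewrite mark_cat -catA -emitted_cat /= => rest.
have body : run (Seq (set_mark k eR) (Seq (emit em eR) (Store (Const 0) (sigma_of eR))))
    (layout u v x g l M, o) (layout (sg u) v x g l M1, o ++ emitted em [:: u])
    (1 + (2 + 1)).
  apply: run_seq; first exact: run_set_mark.
  apply: run_seq; first exact: run_emit.
  by apply: run_set_r => //; apply: eval_sigma.
apply: run_leq (step_while bd ss _ body rest) _; last by rewrite mulnS.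
by rewrite neq_eq0 Hstop /= eq_sym.
Qed.

Lemma order_leq_n (u : 'I_n) : fingraph.order sg u <= n.
Proof. by rewrite -[leqRHS]card_ord; apply: max_card. Qed.

Lemma run_walk_cycle k em e (u : 'I_n) r v x g l M o :
    bounded r v x g l M -> k <= 2 -> small_expr (neq eR e) ->
    small_expr (Add (Const 8) e) -> small_expr (sigma_of e) ->
    (forall r' M', ev (layout r' v x g l M') e = u) ->
  run (walk_cycle k em e) (layout r v x g l M, o)
      (layout u v x g l (mark M k (orbit sg u)),
       o ++ emitted em (orbit_tail sg u)) (5 * n).
Proof.
move=> bd k2 s1 s2 s3 eu; have [[_ le_v le_x le_g le_l] le_M] := bd.
have le_M1 := mark_le2 [:: u] le_M k2.
have bd1 : bounded r v x g l (mark M k [:: u]) by case: bd => -[].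
have bd2 : bounded (sg u) v x g l (mark M k [:: u]) by do 2!split=> //; apply: ord_le2.
have r1 := run_set_mark o bd k2 s2 (eu r M).
have r2 := run_set_r o bd1 s3 (eval_sigma (eu _ _)).
have r3 : run (walk k em e) (layout (sg u) v x g l (mark M k [:: u]), o)
   (layout u v x g l (mark M k (orbit sg u)), o ++ emitted em (orbit_tail sg u))
   (5 * (fingraph.order sg u).-1).+1.
  have -> : mark M k (orbit sg u) = mark (mark M k [:: u]) k (orbit_tail sg u).
    by rewrite mark_cat orbit_cons.
  apply: run_walk => //.
    by rewrite -iterSr orderSpred iter_order.
  by have := orbit_uniq sg u; rewrite orbit_cons => /andP[].
apply: run_leq (run_seq r1 (run_seq r2 r3)) _.
have := order_leq_n u; rewrite -orderSpred; lia.
Qed.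

(** [Inv] is indexed by the vertices still to be visited and does not mention the loop variable,
    which the loop itself updates. *)
Lemma run_for body kb (Inv : seq 'I_n -> nat -> nat -> nat -> nat ->
                              (nat -> nat) -> seq nat -> Prop) :
    (forall vs r x g l M o, Inv vs r x g l M o -> bounded r 0 x g l M) ->
    (forall (u : 'I_n) vs r x g l M o, Inv (u :: vs) r x g l M o ->
       bounded r u x g l M ->
       exists r' x' g' l' M' o', Inv vs r' x' g' l' M' o' /\
         run body (layout r u x g l M, o) (layout r' u x' g' l' M', o') kb) ->
  forall r v x g l M o, Inv (enum 'I_n) r x g l M o -> v <= n.*2 ->
  exists r' x' g' l' M' o', Inv [::] r' x' g' l' M' o' /\
    run (for_vertices body) (layout r v x g l M, o) (layout r' n x' g' l' M', o')
        (n * (kb + 2) + 2).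
Proof.
move=> Ibd Istep r v x g l M o I0 le_v.
have bdv vs r' x' g' l' M' o' y : Inv vs r' x' g' l' M' o' -> y <= n.*2 ->
    bounded r' y x' g' l' M'.
  by move=> /Ibd [[? _ ? ? ?] ?].
have n_le : n <= n.*2 by rewrite -addnn leq_addr.
have setv y e r' x' g' l' M' o' v' : bounded r' v' x' g' l' M' -> small_expr e ->
    ev (layout r' v' x' g' l' M') e = y ->
    run (Store (Const 1) e) (layout r' v' x' g' l' M', o')
        (layout r' y x' g' l' M', o') 1.
  move=> bd se <-; set y' := ev _ _.
  have [_ <- _ _ _] := update_layout r' v' x' g' l' M' y'.
  by apply: run_store => //; apply: bounded_layout.
suff loop vs a r0 x0 g0 l0 M0 o0 : [seq val z | z <- vs] = iota a (size vs) ->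
    a + size vs = n -> Inv vs r0 x0 g0 l0 M0 o0 ->
    exists r' x' g' l' M' o', Inv [::] r' x' g' l' M' o' /\
    run (While (Sub eN eV) (Seq body (Store (Const 1) (Add eV (Const 1)))))
      (layout r0 a x0 g0 l0 M0, o0) (layout r' n x' g' l' M', o')
      (size vs * (kb + 2) + 1).
  have [||r' [x' [g' [l' [M' [o' [I' rn]]]]]]] := loop (enum 'I_n) 0 r x g l M o _ _ I0.
  - by rewrite size_enum_ord val_enum_ord.
  - by rewrite size_enum_ord.
  exists r', x', g', l', M', o'; split=> //; rewrite size_enum_ord in rn.
  have s0 := setv 0 (Const 0) _ _ _ _ _ o _ (bdv _ _ _ _ _ _ _ v I0 le_v) isT erefl.
  by apply: run_leq (run_seq s0 rn) _; lia.
elim: vs a r0 x0 g0 l0 M0 o0 => [|u vs IH] a r0 x0 g0 l0 M0 o0 /=.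
  rewrite addn0 => _ -> I'; exists r0, x0, g0, l0, M0, o0; split=> //.
  apply: stop_while => //; first exact: bdv I' n_le.
  by rewrite /= inp0 subnn.
case=> ua vsE an I'; rewrite -ua.
have bdu := bdv _ _ _ _ _ _ _ u I' (ord_le2 u).
have [r1 [x1 [g1 [l1 [M1 [o1 [I1 r1n]]]]]]] := Istep _ _ _ _ _ _ _ _ I' bdu.
have [|r' [x' [g' [l' [M' [o' [I2 rn]]]]]]] := IH a.+1 _ _ _ _ _ _ vsE _ I1.
  by rewrite addSn -addnS.
exists r', x', g', l', M', o'; split=> //.
have bdu1 := bdv _ _ _ _ _ _ _ u I1 (ord_le2 u).
have sv := setv a.+1 (Add eV (Const 1)) _ _ _ _ _ o1 _ bdu1 isT _.
apply: run_leq (step_while bdu _ _ (run_seq r1n (sv _)) rn) _ => //.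
- by rewrite /= inp0 -lt0n subn_gt0.
- by rewrite /= ua addn1.
by rewrite mulSn; move: (size vs * _) => q; lia.
Qed.

Lemma run_scan_cycles k em (S : seq 'I_n) r v x g l M o :
    bounded r v x g l M -> 0 < k <= 2 -> l <= n ->
    (forall u : 'I_n, (M u == k) = (u \in S)) ->
  let rs := scan sg S (enum 'I_n) in
  exists2 r', r' <= n.*2 &
  run (scan_cycles k em) (layout r v x g l M, o)
      (layout r' n x g (l + size rs) (mark M k (orbits sg rs)),
       o ++ emitted em (excursions sg rs)) (n * (5 * n + 8) + 2).
Proof.
move=> bd /andP[k_gt0 k2] le_ln MS rs.
have [[le_r le_v le_x le_g le_l] le_M] := bd.
(* [S'] holds the vertices that carry mark [k] so far; scanning the rest from [S'] must complete the
   current state to the intended final one. *)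
pose Inv (vs : seq 'I_n) r' x' g' l' M' o' :=
  [/\ bounded r' 0 x' g' l' M', x' = x, g' = g, l' + size vs <= n.*2 &
    exists S' : seq 'I_n, [/\ forall u : 'I_n, (M' u == k) = (u \in S'),
      l' + size (scan sg S' vs) = l + size rs,
      mark M' k (orbits sg (scan sg S' vs)) = mark M k (orbits sg rs) &
      o' ++ emitted em (excursions sg (scan sg S' vs)) =
        o ++ emitted em (excursions sg rs)]].
have I0 : Inv (enum 'I_n) r x g l M o.
  split=> //; first by rewrite size_enum_ord -addnn leq_add2r.
  by exists S.
have [||r' [x' [g' [l' [M' [o' [I' rn]]]]]]] :=
    @run_for (If (Mul (neq (mark_of eV) (Const k)) (neq (sigma_of eV) eV))
       (Seq (emit em eV) (Seq (walk_cycle k em eV)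
          (Seq (emit em eV) (Store (Const 4) (Add eL (Const 1))))))
       Skip) (5 * n + 6) Inv _ _ r v x g l M o I0 le_v.
- by move=> vs r' x' g' l' M' o' [].
- move=> u vs r' x' g' l' M' o' [_ -> -> le_l' [S' [MS' lE ME oE]]] bd'.
  have sm : small_expr (Mul (neq (mark_of eV) (Const k)) (neq (sigma_of eV) eV)).
    by rewrite /small_expr /= (leq_trans k2).
  have condE : (ev (layout r' u x g l' M')
      (Mul (neq (mark_of eV) (Const k)) (neq (sigma_of eV) eV)) != 0) =
      ~~ ((u \in S') || (sg u == u)).
    rewrite eval_Mul muln_eq0 negb_or !neq_eq0 (eval_sigma (u := u)) //.
    rewrite -[ev _ (mark_of _)]/(M' u).
    by rewrite MS' negb_or.
  move: lE ME oE => /=; case: ifPn => [skip|act] lE ME oE.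
    exists r', x, g, l', M', o'; split.
      split=> //; [by case: bd' => -[? _ ? ? ?] ? | by move: le_l' => /=; lia |].
      by exists S'.
    apply: run_leq (step_if bd' sm _) _; first by rewrite condE skip; apply: run_skip.
    lia.
  have [[_ _ _ _ le_l1] le_M'] := bd'.
  have le_M1 := mark_le2 (orbit sg u) le_M' k2.
  have le_u := ord_le2 u.
  have l1 : l'.+1 + size vs <= n.*2 by move: le_l' => /=; lia.
  have bd1 y : y <= n.*2 -> bounded u u x g y (mark M' k (orbit sg u)).
    by move=> le_y; split.
  exists u, x, g, l'.+1, (mark M' k (orbit sg u)), (o' ++ emitted em (excursion sg u)).
  split.
    split=> //; first by split=> //; split=> //; lia.
    exists (orbit sg u ++ S'); split.
    - by move=> z; rewrite markE // mem_cat -MS'; case: ifP => //; rewrite eqxx.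
    - by rewrite addSnnS.
    - by rewrite mark_cat -ME.
    by rewrite -catA -emitted_cat -oE.
  pose o1 := o' ++ emitted em [:: u]; pose o2 := o1 ++ emitted em (orbit_tail sg u).
  pose M1 := mark M' k (orbit sg u).
  have e1 : run (emit em eV) (layout r' u x g l' M', o') (layout r' u x g l' M', o1) 2.
    exact: run_emit.
  have e2 : run (walk_cycle k em eV) (layout r' u x g l' M', o1)
      (layout u u x g l' M1, o2) (5 * n) by apply: run_walk_cycle.
  have e3 : run (emit em eV) (layout u u x g l' M1, o2)
      (layout u u x g l' M1, o2 ++ emitted em [:: u]) 2.
    by apply: run_emit => //; apply: bd1.
  have e4 : run (Store (Const 4) (Add eL (Const 1)))
      (layout u u x g l' M1, o2 ++ emitted em [:: u])
      (layout u u x g l'.+1 M1, o2 ++ emitted em [:: u]) 1.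
    have := @run_store inp K K_gt3 inp_lt _ (o2 ++ emitted em [:: u]) (Const 4)
      (Add eL (Const 1)) (bounded_layout (bd1 _ le_l1)) isT isT.
    by rewrite /= addn1; have [_ _ _ _ [-> _]] := update_layout u u x g l' M1 l'.+1.
  have <- : o2 ++ emitted em [:: u] = o' ++ emitted em (excursion sg u).
    by rewrite /o2 /o1 -!catA -!emitted_cat /excursion -cats1.
  apply: run_leq (step_if bd' sm _) _.
    rewrite condE act; exact: run_seq e1 (run_seq e2 (run_seq e3 e4)).
  lia.
case: I' => bd' xE gE _ [S' [_ lE ME oE]].
exists r'; first by case: bd' => -[].
move: lE ME oE rn => /=; rewrite mark_nil addn0 xE gE => <- <-.
rewrite (_ : emitted em (excursions sg [::]) = [::]) ?cats0; last by case: (em).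
by move=> <-; rewrite -addnA.
Qed.

(** The flag [isx] lets one proof serve both target cells. *)
Lemma run_argmin (isx : bool) (cond : expr) (C : 'I_n -> 'I_n -> bool) r v x g l M o :
    bounded r v x g l M -> small_expr cond ->
    (forall u b : 'I_n,
       (ev (layout r u (if isx then b : nat else x) (if isx then g else b) l M)
           cond != 0) = C u b) ->
  let b := foldl (fun b u => if C u b then u else b) c (enum 'I_n) in
  run (argmin (if isx then 2 else 3) cond) (layout r v x g l M, o)
      (layout r n (if isx then b : nat else x) (if isx then g else b) l M, o)
      (n * 4 + 3).
Proof.
move=> bd sc condE b.
have [[le_r le_v le_x le_g le_l] le_M] := bd.
have set_dst (y : 'I_n) e v' x' g' : bounded r v' x' g' l M -> small_expr e ->
    ev (layout r v' x' g' l M) e = y ->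
    run (Store (Const (if isx then 2 else 3)) e) (layout r v' x' g' l M, o)
      (layout r v' (if isx then y : nat else x') (if isx then g' else y) l M, o) 1.
  move=> bd' se eE.
  have sd : small_expr (Const (if isx then 2 else 3)) by case: isx {condE b}.
  have := @run_store inp K K_gt3 inp_lt _ o _ _ (bounded_layout bd') sd se.
  rewrite eE; have [_ _ E2 E3 _] := update_layout r v' x' g' l M y.
  by case: isx {condE b sd}; rewrite /= ?E2 ?E3.
have bdl v' (y : 'I_n) : v' <= n.*2 ->
    bounded r v' (if isx then y : nat else x) (if isx then g else y) l M.
  by move=> le_v'; split=> //; split=> //; case: (isx) => //; apply: ord_le2.
pose Inv (vs : seq 'I_n) r' x' g' l' M' o' :=
  exists y : 'I_n, [/\ x' = (if isx then y : nat else x),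
    g' = (if isx then g else y), [/\ r' = r, l' = l, M' = M & o' = o] &
    foldl (fun b u => if C u b then u else b) y vs = b].
have I0 : Inv (enum 'I_n) r (if isx then c : nat else x) (if isx then g else c) l M o.
  by exists c.
have [||r' [x' [g' [l' [M' [o' [I' rn]]]]]]] :=
    @run_for (If cond (Store (Const (if isx then 2 else 3)) eV) Skip) 2 Inv
      _ _ r v _ _ l M o I0 le_v.
- move=> vs r' x' g' l' M' o' [y [-> -> [-> -> -> _] _]].
  exact: bdl.
- move=> u vs r' x' g' l' M' o' [y [-> -> [-> -> -> ->] yE]] bd'.
  pose y' := if C u y then u else y.
  exists r, (if isx then y' : nat else x), (if isx then g else y'), l, M, o.
  split; first by exists y'.
  apply: step_if => //; rewrite condE /y'; case: ifP => _; last exact: run_skip.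
  have := set_dst u eV _ _ _ bd' isT erefl.
  by case: (isx).
case: I' rn => y [-> -> [-> -> -> ->] /= <-] rn.
by apply: run_leq (run_seq (set_dst c eC _ _ _ bd isT inp1) rn) _; lia.
Qed.

Definition min_vertex (C : 'I_n -> 'I_n -> bool) : 'I_n :=
  foldl (fun b u => if C u b then u else b) c (enum 'I_n).

Definition lighter_rel (u b : 'I_n) : bool :=
  (u \in orbit sg c) && (num u * den b < num b * den u).

Definition locked_reps : seq 'I_n := scan sg (orbit sg c) (enum 'I_n).

(** The vertices in the test are those marked by the silent pass; [helper_factorE] identifies the
    others with the happy leaves. *)
Definition helper_factor (u : 'I_n) : nat :=
  if u \in orbit sg c ++ orbits sg locked_reps then (size locked_reps).-1
  else (size locked_reps).+1.

Definition better_rel (u b : 'I_n) : bool :=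
  num u * helper_factor u * den b < num b * helper_factor b * den u.

Lemma size_scan_leq (S vs : seq 'I_n) : size (scan sg S vs) <= size vs.
Proof.
elim: vs S => //= v vs IH S; case: ifP => _ /=; last exact: IH.
exact: leq_trans (IH S) _.
Qed.

Lemma run_star_program (xv := min_vertex lighter_rel) (gv := min_vertex better_rel) :
    xv \in orbit sg c ->
  exists m, run star_program (fun=> 0, [::])
    (m, enc_swaps (center_swaps c (schedule sg c xv gv))) (100 * n.+1 ^ 2).
Proof.
move=> xX; pose X := orbit sg c; pose L := size locked_reps.
have bd0 r v x g l M : r <= n.*2 -> v <= n.*2 -> x <= n.*2 -> g <= n.*2 ->
    l <= n.*2 -> (forall u, M u <= 2) -> bounded r v x g l M by [].
have le_n : n <= n.*2 by rewrite -addnn leq_addr.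
have le_o (u : 'I_n) : u <= n.*2 := ord_le2 u.
have le_L : L <= n by rewrite /L (leq_trans (size_scan_leq _ _)) // size_enum_ord.
have le_L2 : L <= n.*2 := leq_trans le_L le_n.
have -> : (fun=> 0) = layout 0 0 0 0 0 (fun=> 0).
  by apply: functional_extensionality => -[|[|[|[|[|[|[|[|j]]]]]]]].
have eCE m : ev m eC = c by [].
pose M1 := mark (fun=> 0) 1 X.
have le_M1 : forall u, M1 u <= 2 by apply: mark_le2.
have M1E u : M1 (u : 'I_n) = (u \in X) by rewrite /M1 markE //; case: ifP.
have s1 : run (walk_cycle 1 false eC) (layout 0 0 0 0 0 (fun=> 0), [::])
    (layout c 0 0 0 0 M1, [::]) (5 * n).
  by apply: run_walk_cycle => //; apply: bd0.
have s2 : run (argmin 2 lighter) (layout c 0 0 0 0 M1, [::])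
    (layout c n xv 0 0 M1, [::]) (n * 4 + 3).
  apply: (@run_argmin true lighter lighter_rel) => //.
  move=> u b; rewrite /lighter_rel eval_Mul muln_eq0 negb_or.
  congr (_ && _); first by rewrite -[ev _ _]/(M1 u) M1E; case: (_ \in _).
  rewrite eval_Sub !eval_Mul (eval_num (e := eX) (u := b)) //.
  rewrite (eval_num (e := eV) (u := u)) // (eval_den (e := eX) (u := b)) //.
  rewrite (eval_den (e := eV) (u := u)) //.
  by rewrite subn_eq0 -ltnNge.
pose M2 := mark M1 1 (orbits sg locked_reps).
have le_M2 : forall u, M2 u <= 2 by apply: mark_le2.
have M2E u : M2 (u : 'I_n) = (u \in X ++ orbits sg locked_reps).
  by rewrite /M2 /M1 mark_cat markE //; case: ifP.
have [r3 le_r3 s3] : exists2 r', r' <= n.*2 & run (scan_cycles 1 false)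
    (layout c n xv 0 0 M1, [::]) (layout r' n xv 0 L M2, [::]) (n * (5 * n + 8) + 2).
  have [||//||r' le_r' rn] := @run_scan_cycles 1 false X c n xv 0 0 M1 [::].
  - exact: bd0.
  - by [].
  - by move=> u; rewrite M1E; case: (u \in X).
  by exists r'.
have s4 : run (argmin 3 better_helper) (layout r3 n xv 0 L M2, [::])
    (layout r3 n xv gv L M2, [::]) (n * 4 + 3).
  apply: (@run_argmin false better_helper better_rel) => //.
  move=> u b; rewrite /better_rel; set m := layout _ _ _ _ _ _.
  rewrite -[ev m _]/(ev m (key_of eG) * ev m (den_of eV) -
                     ev m (key_of eV) * ev m (den_of eG)).
  rewrite (eval_den (e := eV) (u := u)) // (eval_den (e := eG) (u := b)) //.
  have keyE e (z : 'I_n) : ev m e = z -> ev m eL = L -> ev m (mark_of e) = M2 z ->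
      ev m (key_of e) = num z * helper_factor z.
    move=> ez lE mE; rewrite /key_of eval_Mul (eval_num ez) eval_Add !eval_Mul !eval_Sub.
    rewrite eval_Add lE mE M2E /helper_factor -/L -/X; congr (_ * _).
    by case: (z \in _); rewrite /= ?mul1n ?mul0n ?addn0 ?add0n ?subn1 ?addn1.
  rewrite (keyE eG b) // (keyE eV u) //.
  by rewrite subn_eq0 -ltnNge.
pose M3 := mark M2 2 X.
have le_M3 : forall u, M3 u <= 2 by apply: mark_le2.
(* Mark 2 singles out the unlocked cycle because all earlier marks are 0 or 1. *)
have M3E u : (M3 (u : 'I_n) == 2) = (u \in X).
  by rewrite /M3 markE //; case: ifP => // _; rewrite M2E; case: (_ \in _).
have s5 : run (walk_cycle 2 false eC) (layout r3 n xv gv L M2, [::])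
    (layout c n xv gv L M3, [::]) (5 * n).
  by apply: run_walk_cycle => //; apply: bd0.
have s6 : run (Store (Const 0) (sigma_of eC)) (layout c n xv gv L M3, [::])
    (layout (sg c) n xv gv L M3, [::]) 1.
  by apply: run_set_r => //; apply: eval_sigma.
pose i := findex sg c xv; pose p1 := traject sg (sg c) i.
have c_xv : fconnect sg c xv by rewrite fconnect_orbit.
have i_lt : i < fingraph.order sg c by apply: findex_max.
(* Stopping at [sg xv] rather than at [xv] makes the walk include [xv], and leaves it empty when
   [xv] is [c]. *)
have s7 : run (walk 0 true (sigma_of eX)) (layout (sg c) n xv gv L M3, [::])
    (layout (sg xv) n xv gv L M3, emitted true p1) (5 * n).+1.
  apply: run_leq (run_walk (z := sg xv) (j := i) true [::] _ _ _ _ _ _) _ => //.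
  - by move=> r M; apply: eval_sigma.
  - by rewrite -iterSr /= iter_findex.
  (* An earlier visit to [sg xv] would mean that [xv] is reached from [c] in fewer than [i]
     steps. *)
  - apply/negP=> /trajectP[k lt_k]; rewrite -iterSr /= => /sg_inj xk.
    have := findex_iter (ltn_trans lt_k i_lt); rewrite -xk -/i => E.
    by rewrite E ltnn in lt_k.
  by have := order_leq_n c; lia.
pose body := if gv \in X then excursions sg (scan sg X (enum 'I_n))
   else gv :: excursions sg (scan sg (orbit sg gv ++ X) (enum 'I_n)) ++
          rcons (orbit_tail sg gv) gv.
have [r8 [l8 [M8 [le_r8 le_l8 le_M8 s8]]]] : exists r' l' M',
   [/\ r' <= n.*2, l' <= n.*2, forall u, M' u <= 2 &
   run (If (neq (mark_of eG) (Const 2))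
         (Seq (walk_cycle 2 false eG)
         (Seq (emit true eG)
         (Seq (scan_cycles 2 true)
         (Seq (Store (Const 0) (sigma_of eG))
         (Seq (walk 0 true eG)
              (emit true eG))))))
         (scan_cycles 2 true))
     (layout (sg xv) n xv gv L M3, emitted true p1)
     (layout r' n xv gv l' M', emitted true p1 ++ emitted true body)
     (5 * n * n + 20 * n + 20)].
  have sm : small_expr (neq (mark_of eG) (Const 2)) by [].
  have bd7 : bounded (sg xv) n xv gv L M3 by apply: bd0.
  have condE : (ev (layout (sg xv) n xv gv L M3) (neq (mark_of eG) (Const 2)) != 0) =
      (gv \notin X).
    by rewrite neq_eq0 -[ev _ (mark_of _)]/(M3 gv) M3E.
  pose rsize (S : seq 'I_n) := size (scan sg S (enum 'I_n)).
  have le_rs S : L + rsize S <= n.*2.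
    rewrite -addnn leq_add // /rsize (leq_trans (size_scan_leq _ _)) //.
    by rewrite size_enum_ord.
  rewrite /body; case: ifPn condE => gX condE.
    have [//|//|//|r' le_r' rn] := @run_scan_cycles 2 true X (sg xv) n xv gv L M3
      (emitted true p1) bd7.
    eexists r', (L + rsize X), _; split; last first.
    - apply: run_leq (step_if bd7 sm _) _; first by rewrite condE; apply: rn.
      lia.
    - exact: mark_le2.
    - exact: le_rs.
    - exact: le_r'.
  pose S := orbit sg gv ++ X; pose rs := scan sg S (enum 'I_n).
  pose M4 := mark M3 2 (orbit sg gv).
  have le_M4 : forall u, M4 u <= 2 by apply: mark_le2.
  pose o1 := emitted true p1 ++ emitted true [:: gv].
  pose o2 := o1 ++ emitted true (excursions sg rs).
  pose o3 := o2 ++ emitted true (orbit_tail sg gv).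
  pose M5 := mark M4 2 (orbits sg rs).
  have le_M5 : forall u, M5 u <= 2 by apply: mark_le2.
  have t1 : run (walk_cycle 2 false eG) (layout (sg xv) n xv gv L M3, emitted true p1)
      (layout gv n xv gv L M4, emitted true p1) (5 * n).
    rewrite -[X in (layout gv _ _ _ _ _, X)]cats0.
    exact: (run_walk_cycle false _ bd7).
  have t2 : run (emit true eG) (layout gv n xv gv L M4, emitted true p1)
      (layout gv n xv gv L M4, o1) 2 by apply: run_emit.
  have M4S (u : 'I_n) : (M4 u == 2) = (u \in S).
    by rewrite /M4 markE // /S mem_cat -M3E; case: ifP.
  have bd4 : bounded gv n xv gv L M4 by apply: bd0.
  have [//|//|//|r' le_r' t3] := @run_scan_cycles 2 true S gv n xv gv L M4 o1 bd4.
  rewrite -/rs -/M5 -/o2 in t3.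
  have le_Lr : L + size rs <= n.*2 := le_rs S.
  have t4 : run (Store (Const 0) (sigma_of eG))
      (layout r' n xv gv (L + size rs) M5, o2)
      (layout (sg gv) n xv gv (L + size rs) M5, o2) 1.
    by apply: run_set_r => //; apply: eval_sigma.
  have t5 : run (walk 0 true eG) (layout (sg gv) n xv gv (L + size rs) M5, o2)
      (layout gv n xv gv (L + size rs) M5, o3) (5 * (fingraph.order sg gv).-1).+1.
    apply: (run_walk (z := gv) (j := (fingraph.order sg gv).-1) true o2) => //.
      by rewrite -iterSr orderSpred iter_order.
    by have := orbit_uniq sg gv; rewrite orbit_cons => /andP[].
  have t6 : run (emit true eG) (layout gv n xv gv (L + size rs) M5, o3)
      (layout gv n xv gv (L + size rs) M5, o3 ++ emitted true [:: gv]) 2.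
    by apply: run_emit.
  exists gv, (L + size rs), M5; split=> //.
  rewrite -/S -/rs; have -> : emitted true p1 ++ emitted true
      (gv :: excursions sg rs ++ rcons (orbit_tail sg gv) gv) =
      o3 ++ emitted true [:: gv].
    by rewrite /o3 /o2 /o1 -!catA -!emitted_cat -cats1 emitted_cat.
  apply: run_leq (step_if bd7 sm _) _.
    rewrite condE.
    exact: run_seq t1 (run_seq t2 (run_seq t3 (run_seq t4 (run_seq t5 t6)))).
  by have := order_leq_n gv; lia.
have s9 : run (Store (Const 0) (sigma_of eX))
    (layout r8 n xv gv l8 M8, emitted true p1 ++ emitted true body)
    (layout (sg xv) n xv gv l8 M8, emitted true p1 ++ emitted true body) 1.
  by apply: run_set_r => //; apply: eval_sigma.
pose p2 := traject sg (sg xv) ((fingraph.order sg c).-1 - i).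
have s10 : run (walk 0 true eC)
    (layout (sg xv) n xv gv l8 M8, emitted true p1 ++ emitted true body)
    (layout c n xv gv l8 M8, (emitted true p1 ++ emitted true body) ++ emitted true p2)
    (5 * n).+1.
  apply: run_leq (run_walk (z := c) (j := (fingraph.order sg c).-1 - i) true
    _ _ _ _ _ _ _) _ => //.
  - rewrite -iterSr -(iter_findex c_xv) -iterD -/i.
    have -> : ((fingraph.order sg c).-1 - i).+1 + i = fingraph.order sg c by lia.
    exact: iter_order.
  - have := orbit_uniq sg c; rewrite orbit_cons (orbit_tail_split xX) => /andP[+ _].
    by rewrite mem_cat negb_or => /andP[].
  by have := order_leq_n c; lia.
exists (layout c n xv gv l8 M8).
have -> : enc_swaps (center_swaps c (schedule sg c xv gv)) =
   (emitted true p1 ++ emitted true body) ++ emitted true p2.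
  by rewrite -!emitted_cat -catA.
apply: run_leq.
  apply: run_seq s1 (run_seq s2 (run_seq s3 (run_seq s4 (run_seq s5 (run_seq s6
    (run_seq s7 (run_seq s8 (run_seq s9 s10)))))))).
by rewrite expnS expn1; nia.
Qed.

End Simulation.

(** * Rational weights, input length and the polynomial bound *)

Lemma foldl_argmin d (T : eqType) (V : orderType d) (P : pred T) (key : T -> V)
    (C : T -> T -> bool) (b : T) (s : seq T) :
    (forall u v, C u v = P u && (key u < key v)%O) -> P b ->
  let m := foldl (fun b u => if C u b then u else b) b s in
  P m /\ forall u, u \in b :: s -> P u -> (key m <= key u)%O.
Proof.
move=> CE; elim: s b => [|v s IH] b Pb /=.
  by split=> // u; rewrite inE => /eqP ->.
rewrite CE; case: ifPn => [/andP[Pv lt_v]|nv].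
  have [Pm le_m] := IH v Pv; split=> // u; rewrite inE => /orP[/eqP ->|us] Pu.
    exact: le_trans (le_m v (mem_head _ _) Pv) (ltW lt_v).
  exact: le_m.
have [Pm le_m] := IH b Pb; split=> // u; rewrite !inE => /or3P[/eqP ->|/eqP ->|us] Pu.
- by apply: le_m => //; apply: mem_head.
- move: nv; rewrite Pu /= -leNgt => le_b.
  by apply: le_trans (le_m b (mem_head _ _) Pb) le_b.
by apply: le_m => //; rewrite inE us orbT.
Qed.

(** Both sides are multiplied by the positive denominators. The factors [a] and [b] let the lemma
    serve for weights and helper keys alike. *)
Lemma lt_rat_cross (p q : rat) (a b : nat) : (0 < p)%R -> (0 < q)%R ->
  (p * a%:R < q * b%:R)%R =
  (`|numq p| * a * `|denq q| < `|numq q| * b * `|denq p|)%N.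
Proof.
move=> p_gt0 q_gt0.
have dp (r : rat) : (0 < (`|denq r|%N)%:R :> rat)%R.
  by rewrite ltr0n absz_gt0 denq_neq0.
have nE (r : rat) : (0 < r)%R -> (r * (`|denq r|%N)%:R = (`|numq r|%N)%:R)%R.
  move=> r_gt0; have nr : (0 < numq r)%R by rewrite numq_gt0.
  rewrite !pmulrn (gtz0_abs nr) (gtz0_abs (denq_gt0 r)).
  by rewrite -[X in (X * _)%R]divq_num_den divfK // intr_eq0 denq_neq0.
rewrite -(ltr_pM2r (dp p)) -(ltr_pM2r (dp q)) -(ltr_nat rat) !natrM.
by rewrite -!nE //; congr (_ < _)%R; ring.
Qed.

Section PolynomialTime.
Variable J : star_input.

Notation n := (in_n J).
Notation I := (in_inst J).
Notation c := (in_center J).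
Notation inp := (enc_input J).
Notation sg := (sigma (in_inst J)).
Notation K := (input_length (enc_input J) + 4).

Lemma inpE : [/\ nth 0 inp 0 = n, nth 0 inp 1 = c,
  forall v : 'I_n, nth 0 inp (2 + v) = tok0 I v,
  forall t : 'I_n, nth 0 inp (2 + n + t) = dest I t &
  (forall t : 'I_n, nth 0 inp (2 + 2 * n + t) = `|numq (weight I t)|%N) /\
  (forall t : 'I_n, nth 0 inp (2 + 3 * n + t) = `|denq (weight I t)|%N)].
Proof.
split=> //; [move=> v|move=> t|split=> t]; rewrite /enc_input.
- by rewrite [nth _ _ _]nth_enum_map.
- by rewrite -addnA [nth _ _ _]nth_enum_cat nth_enum_map.
- rewrite mul2n -addnn -!addnA [nth _ _ _]nth_enum_cat nth_enum_cat.
  by rewrite nth_enum_map.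
rewrite (_ : 3 * n = n + (n + n)); last by lia.
rewrite -!addnA [nth _ _ _]nth_enum_cat !nth_enum_cat.
by rewrite -[map _ _]cats0 nth_enum_map.
Qed.

(** The successor covers positions beyond the input, where the default [0] still has bit length
    1. *)
Lemma input_bits i : bits (nth 0 inp i) <= (input_length inp).+1.
Proof.
have [lt_i|ge_i] := ltnP i (size inp); last first.
  by rewrite nth_default // /bits trunc_log0.
rewrite /input_length (big_nth 0) (bigD1_seq i) ?mem_index_iota ?iota_uniq //=.
by rewrite ltnW // ltnS leq_addr.
Qed.

Lemma inp_lt i : nth 0 inp i < 2 ^ K.
Proof.
apply: leq_trans (ltn_bits _) _; rewrite leq_exp2l //.
by apply: leq_trans (input_bits i) _; rewrite -addn1 leq_add2l.
Qed.

(** [n] is itself an input entry, and the spare bits of [K] leave room for doubling it. *)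
Lemma vertex_bound : n.*2.+2 < 2 ^ K.
Proof.
have := ltn_bits (nth 0 inp 0); have [-> _ _ _ _] := inpE.
have : 2 ^ bits n <= 2 ^ (input_length inp).+1.
  by rewrite leq_exp2l //; have := input_bits 0; have [-> _ _ _ _] := inpE.
rewrite (_ : K = (input_length inp).+1 + 3); last by lia.
rewrite expnD; lia.
Qed.

Lemma vertices_lt_length : n < input_length inp.
Proof.
have : size inp <= input_length inp.
  rewrite -sum1_size; apply: leq_sum => i _; exact: ltn0Sn.
apply: leq_trans; rewrite /enc_input; set s := (X in _ :: _ :: X).
suff le_n : n <= size s by apply: leq_trans le_n _.
by rewrite size_cat size_map size_enum_ord leq_addr.
Qed.

Let wt (u : 'I_n) : rat := weight I (tok0 I u).
Let num (u : 'I_n) : nat := `|numq (wt u)|.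
Let den (u : 'I_n) : nat := `|denq (wt u)|.

Let xv : 'I_n := min_vertex c (lighter_rel c sg num den).
Let gv : 'I_n := min_vertex c (better_rel c sg num den).

Lemma lightest_unlocked : xv \in orbit sg c /\
  {in orbit sg c, forall v, wt xv <= wt v}%R.
Proof.
have [|mX le_m] := @foldl_argmin _ _ _ (mem (orbit sg c)) wt
    (lighter_rel c sg num den) c (enum 'I_n) _ (in_orbit _ _).
  move=> u b; rewrite /lighter_rel.
  have := @lt_rat_cross (wt u) (wt b) 1 1 (weight_gt0 _ _) (weight_gt0 _ _).
  by rewrite !mulr1 !muln1 => ->.
by split=> // v vX; apply: le_m => //; rewrite inE mem_enum orbT.
Qed.

Lemma num_locked_reps : num_locked I c = size (locked_reps c sg).
Proof.
rewrite num_lockedE.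
have <- := @locked_transversal _ _ _ I (orbit sg c) (locked_reps c sg).
  by congr #|locked_cycles I _|; apply/setP=> t; rewrite inE -mem_unlocked iniK.
apply: scan_transversal; first exact: sigma_inj.
by move=> u v uc vu; apply: mem_orbit_trans vu uc.
Qed.

(** A fixed point other than [c] is alone in its orbit, so the orbit of [c] and the nontrivial
    cycles leave out exactly the happy leaves. *)
Lemma helper_factorE u : helper_key I c u = (wt u * (helper_factor c sg u)%:R)%R.
Proof.
rewrite /helper_key /helper_factor -num_locked_reps; congr (_ * _%:R)%R.
have [_ /andP[_ dis] nf cov] : transversal sg (orbit sg c) (locked_reps c sg).
  apply: scan_transversal; first exact: sigma_inj.
  by move=> z v zc vz; apply: mem_orbit_trans vz zc.
have -> : (u \in orbit sg c ++ orbits sg (locked_reps c sg)) =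
   ~~ ((u != c) && (sg u == u)); last by case: (_ && _).
rewrite mem_cat negb_and negbK; have [->|uc] /= := eqVneq u c; first by rewrite in_orbit.
apply/idP/idP => [|/cov //]; apply: contraL => /eqP su.
have := orbit_tail_nil (@sigma_inj _ _ _ I) u; rewrite su eqxx => /eqP tl.
have ou z : u \in orbit sg z -> z = u.
  rewrite mem_orbit_sym; last exact: sigma_inj.
  by rewrite orbit_cons tl inE => /eqP.
rewrite negb_or; apply/andP; split.
  by apply: contraNN uc => /ou ->.
apply/negP=> /flattenP[_ /mapP[r rr ->]] /ou ru.
by move: (allP nf _ rr); rewrite ru su eqxx.
Qed.

Lemma best_helper v : (helper_key I c gv <= helper_key I c v)%R.
Proof.
have [|_ le_m] := @foldl_argmin _ _ _ predT (helper_key I c)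
    (better_rel c sg num den) c (enum 'I_n) _ isT.
  by move=> u b; rewrite !helper_factorE lt_rat_cross ?weight_gt0.
by apply: le_m => //; rewrite inE mem_enum orbT.
Qed.

(** Quadratically many steps in [n], each of duration linear in the input length, give the cubic
    bound. *)
Lemma star_program_correct : exists (m : mem_state) (out : seq nat) (t : nat),
  [/\ exec inp star_program (fun=> 0, [::]) (m, out) t,
      t <= 100 * (10 * (128 * 128)).+1 * input_length inp ^ 3 &
      encodes_star_solution J out].
Proof.
have [xX le_x] := lightest_unlocked.
have [i0 i1 it id_ [inum iden]] := inpE.
have [||||m [t ex le_t]] := @run_star_program n c sg num den inp K (@sigma_inj _ _ _ I)
   _ inp_lt vertex_bound i0 i1 _ _ _ xX.
- by rewrite addn4.
- by move=> u; rewrite it id_.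
- by move=> u; rewrite it inum.
- by move=> u; rewrite it iden.
exists m; eexists; exists t; split; [exact: ex| |].
  apply: leq_trans le_t _; have lt_n := vertices_lt_length.
  (* The length is positive, so [K] is at most five times the length, whence the factor 10. *)
  have le_U : time_unit K <= (10 * (128 * 128)).+1 * input_length inp.
    rewrite /time_unit; move: (input_length inp) lt_n => q lt_n; lia.
  rewrite mulnCA -mulnA leq_mul2l /= [_ ^ 3]expnS mulnA leq_mul //.
  by rewrite leq_exp2r.
exists (center_swaps c (schedule sg c xv gv)).
have [srt val] := schedule_optimal (in_star J) xX le_x best_helper.
by split.
Qed.

End PolynomialTime.

Theorem theorem6p3 :
  (forall (R : realFieldType) (V T : finType) (I : instance R V T)
      (c : V) (x a : T) (oh : option T),
    is_star (edge I) c ->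
    min_token I (unlocked_cycle I c) x ->
    min_token I (Aset I) a ->
    min_token_opt I (Hset I) oh ->
    is_min_sorting_cost I (star_value I c x a oh)) /\
  poly_time_solvable enc_input encodes_star_solution.
Proof.
split; first by move=> R V T I c x a oh star; apply: star_min_cost.
exists star_program, (100 * (10 * (128 * 128)).+1), 3 => J.
exact: star_program_correct.
Qed.
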